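(* Let $\alpha>0$ and let $((A_t,B_t))_{t\in\mathbb Z}$ be an i.i.d. sequence of $\mathbb R^2$-valued random variables with generic element $(A,B)$ such that: $\mathbb E|A|^\alpha=1$, $\mathbb E|B|^\alpha<\infty$, $\mathbb E|A|^\alpha\log^+|A|<\infty$; $\mathbb P(Ax+B=x)<1$ for every $x\in\mathbb R$; and the conditional law of $\log|A|$ given $\{A\ne0\}$ is non-arithmetic. Suppose in addition that $\mathbb E|A|^{\alpha+\eta}<\infty$ and $\mathbb E|B|^{\alpha+\eta}<\infty$ for some $\eta>0$. Let $\Pi_{1,k}=A_1\cdots A_k$ for $k\ge1$, $\Pi_{1,0}=1$, and $$\mathcal X_n=\sum_{i=1}^n\Pi_{1,i-1}B_i,\qquad \mathcal X_n^+=\max(\mathcal X_n,0),\qquad\mathcal X_n^-=-\min(\mathcal X_n,0).$$ Then $$c_+=\lim_{n\to\infty}(\alpha\rho n)^{-1}\mathbb E(\mathcal X_n^+)^\alpha,\qquad c_-=\lim_{n\to\infty}(\alpha\rho n)^{-1}\mathbb E(\mathcal X_n^-)^\alpha,$$ where $\rho=\mathbb E|A|^\alpha\log|A|$ and $c_\pm$ are the constants given in the context.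
   Context: Under the stated hypotheses there is a unique (in law) stationary solution $X\overset{d}{=}AX+B$, with $X$ independent of $(A,B)$, and $\mathbb P(\pm X>x)\sim c_\pm x^{-\alpha}$ as $x\to\infty$ (i.e. $x^\alpha\mathbb P(\pm X>x)\to c_\pm$), where $\rho>0$ and $$c_\pm=\begin{cases}(\alpha\rho)^{-1}\mathbb E[((AX+B)^\pm)^\alpha-((AX)^\pm)^\alpha]&\text{if }\mathbb P(A\ge0)=1,\\(2\alpha\rho)^{-1}\mathbb E[|AX+B|^\alpha-|AX|^\alpha]&\text{if }\mathbb P(A<0)>0.\end{cases}$$ Here $a^+=\max(a,0)$ and $a^-=-\min(a,0)$. *)

(* Defs.v *)
From HB Require Import structures.
From mathcomp Require Import all_boot all_order all_algebra.
From mathcomp Require Import all_classical all_reals all_analysis.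

Set Implicit Arguments.
Unset Strict Implicit.
Unset Printing Implicit Defensive.

Import Order.TTheory GRing.Theory Num.Theory.
Import numFieldNormedType.Exports.

Local Open Scope classical_set_scope.
Local Open Scope ring_scope.

Definition mutual_independence (R : realType) d (T : measurableType d)
    (P : probability T R) (I : eqType) d' (E : measurableType d')
    (Z : I -> T -> E) : Prop :=
  forall (s : seq I) (S : I -> set E), uniq s ->
    (forall i, measurable (S i)) ->
    P (\bigcap_(i in [set` s]) (Z i @^-1` S i)) =
    (\big[*%E/1%E]_(i <- s) P (Z i @^-1` S i))%E.

Definition independent2 (R : realType) d (T : measurableType d)
    (P : probability T R) d1 (E1 : measurableType d1)
    d2 (E2 : measurableType d2) (Y : T -> E1) (Z : T -> E2) : Prop :=
  forall (S1 : set E1) (S2 : set E2), measurable S1 -> measurable S2 ->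
    P ((Y @^-1` S1) `&` (Z @^-1` S2)) =
    (P (Y @^-1` S1) * P (Z @^-1` S2))%E.

Definition same_law (R : realType) d1 (T1 : measurableType d1)
    (P1 : probability T1 R) d2 (T2 : measurableType d2)
    (P2 : probability T2 R) d' (E : measurableType d')
    (Y : T1 -> E) (Z : T2 -> E) : Prop :=
  forall S : set E, measurable S -> P1 (Y @^-1` S) = P2 (Z @^-1` S).

Definition joint (R : realType) (T : Type) (Y Z : T -> R) (w : T) :
  (R * R)%type := (Y w, Z w).

(* Independence is between the pairs: A_t and B_t may depend on each other. *)
Definition iid_copies (R : realType) d (T : measurableType d)
    (P : probability T R) (As Bs : int -> {RV P >-> R})
    d' (T' : measurableType d') (P' : probability T' R)
    (A B : {RV P' >-> R}) : Prop :=
  mutual_independence P (fun t => joint (As t) (Bs t)) /\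
  forall t, same_law P P' (joint (As t) (Bs t)) (joint A B).

Arguments iid_copies {R d T} P As Bs {d' T'} P' A B.

Definition cond_law (R : realType) d (T : measurableType d)
    (P : probability T R) (Y : T -> R) (F : set T) (S : set R) : R :=
  fine (P ((Y @^-1` S) `&` F)) / fine (P F).

(* Only lattices dZ are excluded; mu may be concentrated on some a + dZ. *)
Definition non_arithmetic (R : realType) (mu : set R -> R) : Prop :=
  forall d : R, 0 < d -> mu [set d * k%:~R | k in [set: int]] < 1.

Definition pos_part (R : realType) (x : R) : R := Num.max x 0.
Definition neg_part (R : realType) (x : R) : R := - Num.min x 0.
Definition log_plus (R : realType) (x : R) : R := Num.max (ln x) 0.

Definition stationary_solution (R : realType) d (T : measurableType d)
    (P : probability T R) (A B X : {RV P >-> R}) : Prop :=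
  independent2 P X (joint A B) /\
  same_law P P X (fun w => A w * X w + B w).

Arguments stationary_solution {R d T} P A B X.

(* As ln 0 = 0 and 0 `^ alpha = 0, the integrand vanishes on {A = 0}. *)
Definition rho (R : realType) d (T : measurableType d) (P : probability T R)
    (alpha : R) (A : {RV P >-> R}) : R :=
  fine 'E_P[fun w => `|A w| `^ alpha * ln `|A w|].

Arguments rho {R d T} P alpha A.

(* c_+ for part := pos_part and c_- for part := neg_part. *)
Definition tail_constant (R : realType) d (T : measurableType d)
    (P : probability T R) (alpha : R) (A B X : {RV P >-> R})
    (part : R -> R) : \bar R :=
  if P [set w | 0 <= A w] == 1%E then
    (((alpha * rho P alpha A)^-1)%:E *
      'E_P[fun w => (part (A w * X w + B w) `^ alpha
                     - part (A w * X w) `^ alpha)%R])%E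
  else
    (((2 * alpha * rho P alpha A)^-1)%:E *
      'E_P[fun w => (`|A w * X w + B w| `^ alpha
                     - `|A w * X w| `^ alpha)%R])%E.

Arguments tail_constant {R d T} P alpha A B X part.

Definition Pi1 (R : realType) d (T : measurableType d)
    (As : int -> {mfun T >-> R}) (k : nat) (w : T) : R :=
  \prod_(1 <= j < k.+1) As j%:Z w.

Definition partial_perpetuity (R : realType) d (T : measurableType d)
    (As Bs : int -> {mfun T >-> R}) (n : nat) (w : T) : R :=
  \sum_(1 <= i < n.+1) Pi1 As i.-1 w * Bs i%:Z w.

(* Main.v *)
(** Since X_n = A_1 X' + B_1 with X' independent of (A_1, B_1) and distributed
    as X_{n-1}, and since E|A|^alpha = 1, the moments u_n = E(X_n^+)^alpha and
    v_n = E(X_n^-)^alpha satisfy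
      u_{n+1} = p u_n + q v_n + d_n,   v_{n+1} = q u_n + p v_n + e_n,
    where p = E(A^+)^alpha, q = E(A^-)^alpha, p + q = 1, and
      d_n = E[((A X_n + B)^+)^alpha - ((A X_n)^+)^alpha]
    with (A, B) independent of X_n, and similarly for e_n.  The integrand of
    d_n is O((|A|^alpha + |B|^alpha)(1 + |X_n|^s)) for some s < alpha.  As log|A|
    is non-arithmetic, |A| is not almost surely 1, so E|A|^s < 1; hence the series
    sum_i |Pi_{i-1}|(|B_i| + 1) has a finite moment of order s.  It dominates
    X_n, which converges almost surely, and its limit has the law of X whatever
    the starting point of the recursion.  By dominated convergence d_n and e_n
    converge to the expectations in the definition of c_+ and c_-.  The theorem
    follows by averaging: if q = 0 then u_n and v_n are Cesaro sums, and otherwise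
    u_n + v_n is one while u_n - v_n = o(n), because |p - q| <= 1 and p - q <> 1. *)
Require Import Defs.
From HB Require Import structures.
From mathcomp Require Import all_boot all_order all_algebra.
From mathcomp Require Import all_classical all_reals all_analysis.
From mathcomp Require Import measurable_realfun ring lra.

Set Implicit Arguments.
Unset Strict Implicit.

Import Order.TTheory GRing.Theory Num.Theory.
Import numFieldNormedType.Exports.

Local Open Scope classical_set_scope.
Local Open Scope ring_scope.

(** The sums X_n are backward iterates of y -> A y + B: the pair of index 1 is applied last. For
    each fixed n they have the law of the forward Markov chain, which gives the recursion; but in
    general only the backward order converges pathwise, and dominated convergence relies on that.
    [X] and the sequence live on different probability spaces, so they are compared only through
    integrals of continuous functions. For this reason the increments are first averaged over (A,
    B), which leaves one continuous function of the state, of growth 1 + |y|^s. The order s must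
    satisfy two demands. It is below alpha, because at alpha the recursion no longer contracts and
    the moments of X_n need not stay bounded; and alpha - s is at most 1, because it serves as the
    Hölder exponent with which the perturbation B enters the difference of alpha-th powers. When A
    <= 0 almost surely, p - q = -1, so the recursion for u_n - v_n need not contract geometrically;
    only the averages of its errors are controlled. *)

(** * Product laws and Tonelli's theorem for independent variables *)

Section independence.
Context {R : realType} d (T : measurableType d) (P : probability T R).

Lemma integral_prob_cst (c : \bar R) : (\int[P]_w c = c)%E.
Proof.
rewrite (integral_cst P measurableT c) -[RHS]mule1; congr (_ * _)%E.
exact: probability_setT.
Qed.

(** After division by [P C] the left-hand side is a measure in [V] that agrees with the product
    measure on rectangles, hence everywhere. The event [C] stands for a condition on the past;
    [C = setT] says that [(Z, W)] has the product law. *)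
Lemma independent_prod_measure d1 (E : measurableType d1)
    d2 (S : measurableType d2) (Z : {mfun T >-> E}) (W : {mfun T >-> S})
    (C : set T) (V : set (E * S)) :
    measurable C ->
    (forall S1 S2, measurable S1 -> measurable S2 ->
      P (C `&` (Z @^-1` S1 `&` W @^-1` S2)) =
      (P C * (P (Z @^-1` S1) * P (W @^-1` S2)))%E) ->
    measurable V ->
  P (C `&` (fun w => (Z w, W w)) @^-1` V) =
  (P C * (distribution P Z \x distribution P W) V)%E.
Proof.
move=> mC rect mV.
have mZW : measurable_fun setT (fun w => (Z w, W w)).
  by apply: measurable_fun_pair.
have mZWV : measurable ((fun w => (Z w, W w)) @^-1` V).
  by rewrite -[X in measurable X]setTI; exact: mZW.
have [PC0|PC0] := eqVneq (P C) 0%E.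
  rewrite PC0 mul0e; apply/eqP; rewrite eq_le measure_ge0 andbT -PC0.
  by apply: le_measure; rewrite ?inE//; exact: measurableI.
pose ZW : {mfun T >-> (E * S)%type} :=
  HB.pack (fun w => (Z w, W w)) (isMeasurableFun.Build _ _ _ _ _ mZW).
have PCfin : P C \is a fin_num by rewrite fin_num_measure.
have c_gt0 : 0 < fine (P C).
  by rewrite fine_gt0// lt_neqAle eq_sym PC0 measure_ge0/= -ge0_fin_numE.
have cV0 : (0 <= (fine (P C))^-1)%R by rewrite invr_ge0 ltW.
pose c := NngNum cV0.
have cK : (P C * c%:num%:E = 1)%E.
  by rewrite -[P C]fineK//= -EFinM divff// gt_eqF.
pose m : {measure set (E * S) -> \bar R} :=
  mscale c (pushforward (mrestr P mC) ZW).
have -> : (distribution P Z \x distribution P W)%E V = m mZW V.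
  apply: product_measure_unique => // A B mA mB.
  rewrite /m/= /mscale/= /pushforward /mrestr/= /distribution /pushforward /=.
  have -> : ((fun w => (Z w, W w)) @^-1` (A `*` B) `&` C) =
    (C `&` (Z @^-1` A `&` W @^-1` B)) by rewrite setIC.
  by rewrite rect// muleA [(_%:E * _)%E]muleC cK mul1e.
by rewrite /m/= /mscale/= muleA cK mul1e /pushforward /mrestr/= setIC.
Qed.

(** Tonelli for the joint law, with [Z] exchanged for a copy [Z'] that may live on another space.
    This carries expectations from the space of the sequence to that of the generic pair. *)
Lemma integral_independent d' (T' : measurableType d') (P' : probability T' R)
    d1 (E : measurableType d1) d2 (S : measurableType d2)
    (Z : {mfun T >-> E}) (W : {mfun T >-> S}) (Z' : {mfun T' >-> E})
    (f : E * S -> \bar R) :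
    independent2 P Z W -> same_law P P' Z Z' ->
    measurable_fun setT f -> (forall x, 0 <= f x)%E ->
  (\int[P]_w f (Z w, W w) = \int[P]_w \int[P']_w' f (Z' w', W w))%E.
Proof.
move=> ZW ZZ' mf f0.
have mZW : measurable_fun setT (fun w => (Z w, W w)).
  by apply: measurable_fun_pair.
pose V : {mfun T >-> (E * S)%type} :=
  HB.pack (fun w => (Z w, W w)) (isMeasurableFun.Build _ _ _ _ _ mZW).
transitivity (\int[distribution P V]_x f x)%E.
  by rewrite ge0_integral_distribution.
transitivity (\int[distribution P Z \x distribution P W]_x f x)%E.
  apply: eq_measure_integral => A mA _.
  rewrite /distribution/= /pushforward -[RHS]mul1e -(probability_setT P).
  rewrite -independent_prod_measure ?setTI// => S1 S2 mS1 mS2.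
  by rewrite setTI probability_setT mul1e ZW.
rewrite fubini_tonelli2// ge0_integral_distribution//; last 2 first.
- exact: measurable_fun_fubini_tonelli_G.
- by move=> y; apply: integral_ge0.
apply: eq_integral => w _ /=; rewrite /fubini_G.
have mfw : measurable_fun setT (fun z => f (z, W w)).
  exact: measurable_fun_pair1.
rewrite -(@ge0_integral_distribution _ _ _ _ _ P' Z' (fun z => f (z, W w)))//.
apply: eq_measure_integral => A mA _.
exact: ZZ'.
Qed.

End independence.

(** * Backward iteration of random maps and its Markov operator *)

Section iterated.
Context {R : realType} d (T : measurableType d) (P : probability T R).
Context d1 (E : measurableType d1) d2 (S : measurableType d2).
Variables (Z : nat -> {mfun T >-> E}) (g : E -> S -> S).
Hypothesis mg : measurable_fun setT (fun x : E * S => g x.1 x.2).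
Hypothesis indepZ : mutual_independence P (fun n => Z n : T -> E).

(** The map of index [m] is applied last, and a larger [n] inserts a new map next to the starting
    point [x]. This is the order in which the partial perpetuities grow. *)
Fixpoint iterated (m n : nat) (x : S) (w : T) : S :=
  if n is n'.+1 then g (Z m w) (iterated m.+1 n' x w) else x.

Lemma measurable_iterated m n x : measurable_fun setT (iterated m n x).
Proof.
elim: n m => [|n IH] m /=; first exact: measurable_cst.
have mp : measurable_fun setT (fun w => (Z m w, iterated m.+1 n x w)).
  exact: measurable_fun_pair.
exact: (measurableT_comp mg mp).
Qed.

HB.instance Definition _ m n x := isMeasurableFun.Build _ _ _ _
  (iterated m n x) (measurable_iterated m n x).

(* The past indices [s] are there for the induction on [n]: the step applies
   the induction hypothesis to [m :: s]. *)
Lemma independent_past_iterated m n x (s : seq nat) (A : nat -> set E) (U : set S) :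
    uniq s -> {in s, forall i, (i < m)%N} ->
    (forall i, measurable (A i)) -> measurable U ->
  P ((\bigcap_(i in [set` s]) (Z i @^-1` A i)) `&` iterated m n x @^-1` U) =
  (P (\bigcap_(i in [set` s]) (Z i @^-1` A i)) * P (iterated m n x @^-1` U))%E.
Proof.
elim: n m s A U => [|n IH] m s A U us sm mA mU.
  rewrite /= preimage_cst; case: ifPn => _.
    by rewrite setIT probability_setT mule1.
  by rewrite setI0 measure0 mule0.
have mcap (s' : seq nat) (A' : nat -> set E) : (forall i, measurable (A' i)) ->
    measurable (\bigcap_(i in [set` s']) (Z i @^-1` A' i)).
  move=> mA'; apply: fin_bigcap_measurable => [|i _].
    exact: finite_seq.
  by rewrite -[X in measurable X]setTI; exact: measurable_funP.
have rect (s' : seq nat) (A' : nat -> set E) :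
    uniq s' -> {in s', forall i, (i < m)%N} ->
    (forall i, measurable (A' i)) -> forall S1 S2, measurable S1 -> measurable S2 ->
    P (\bigcap_(i in [set` s']) (Z i @^-1` A' i) `&`
       (Z m @^-1` S1 `&` iterated m.+1 n x @^-1` S2)) =
    (P (\bigcap_(i in [set` s']) (Z i @^-1` A' i)) *
      (P (Z m @^-1` S1) * P (iterated m.+1 n x @^-1` S2)))%E.
  move=> us' s'm mA' S1 S2 mS1 mS2.
  have ms' : m \notin s' by apply/negP => /s'm; rewrite ltnn.
  (* The event on [Z m] becomes one more constraint on the past, which the induction hypothesis at
     [m.+1] covers. *)
  pose A2 i := if i == m then S1 else A' i.
  have A2E i : i \in s' -> A2 i = A' i.
    by move=> is'; rewrite /A2; case: eqP => // im; move: ms'; rewrite -im is'.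
  have mA2 i : measurable (A2 i) by rewrite /A2; case: ifP.
  have cap2 : \bigcap_(i in [set` m :: s']) (Z i @^-1` A2 i) =
      \bigcap_(i in [set` s']) (Z i @^-1` A' i) `&` Z m @^-1` S1.
    have -> : [set` m :: s'] = m |` [set` s'].
      apply/seteqP; split=> i /=; rewrite inE.
        by move=> /predU1P[->|]; [left|right].
      by move=> [->|->]; rewrite ?eqxx ?orbT.
    rewrite bigcap_setU1 setIC; congr (_ `&` _); last first.
      by rewrite /A2 eqxx.
    by apply: eq_bigcapr => i /= /A2E ->.
  have us2 : uniq (m :: s') by rewrite /= ms'.
  rewrite setIA -cap2 IH//; last first.
    by move=> i; rewrite inE => /predU1P[->//|/s'm /ltnW].
  rewrite indepZ// big_cons /A2 eqxx (indepZ us' mA').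
  rewrite [in RHS]muleA; congr (_ * _)%E; rewrite muleC; congr (_ * _)%E.
  by apply: eq_big_seq => i /A2E; rewrite /A2 => ->.
pose V := (fun x : E * S => g x.1 x.2) @^-1` U.
have mV : measurable V by rewrite -[X in measurable X]setTI; exact: mg.
have H (s' : seq nat) (A' : nat -> set E) :
    uniq s' -> {in s', forall i, (i < m)%N} ->
    (forall i, measurable (A' i)) ->
    P (\bigcap_(i in [set` s']) (Z i @^-1` A' i) `&` iterated m n.+1 x @^-1` U) =
    (P (\bigcap_(i in [set` s']) (Z i @^-1` A' i)) *
      (distribution P (Z m) \x distribution P (iterated m.+1 n x)) V)%E.
  move=> us' s'm mA'.
  by rewrite -independent_prod_measure//; [exact: mcap|exact: rect].
rewrite H//; congr (_ * _)%E.
(* The empty past identifies the product measure of [V] with the probability that the iterate lies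
   in [U]. *)
have := @H [::] (fun=> setT) erefl (fun i => ltac:(by [])) (fun=> measurableT).
by rewrite set_nil bigcap_set0 setTI probability_setT mul1e.
Qed.

Lemma independent_iterated m n x : independent2 P (Z m) (iterated m.+1 n x).
Proof.
move=> S1 S2 mS1 mS2.
have := @independent_past_iterated m.+1 n x [:: m] (fun=> S1) S2 erefl.
rewrite set_cons1 bigcap_set1; apply => // i; rewrite inE => /eqP->; exact: ltnSn.
Qed.

Context d' (T' : measurableType d') (P' : probability T' R).
Variable Z' : {mfun T' >-> E}.
Hypothesis lawZ : forall n, same_law P P' (Z n) Z'.

Definition transition (f : S -> \bar R) (y : S) : \bar R :=
  (\int[P']_w f (g (Z' w) y))%E.

Lemma transition_ge0 f : (forall x, 0 <= f x)%E ->
  forall y, (0 <= transition f y)%E.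
Proof. by move=> f0 y; exact: integral_ge0. Qed.

Lemma measurable_transition f : measurable_fun setT f ->
  (forall x, 0 <= f x)%E -> measurable_fun setT (transition f).
Proof.
move=> mf f0.
pose h (x : T' * S) := f (g (Z' x.1) x.2).
apply: (@measurable_fun_fubini_tonelli_G _ _ _ _ _ P' h); last by move=> x; exact: f0.
apply: (measurableT_comp mf).
have mp : measurable_fun setT (fun x : T' * S => (Z' x.1, x.2)).
  by apply: measurable_fun_pair => //; exact: measurableT_comp.
exact: (measurableT_comp mg mp).
Qed.

Lemma integral_iteratedS m n x f :
    measurable_fun setT f -> (forall y, 0 <= f y)%E ->
  (\int[P]_w f (iterated m n.+1 x w) =
   \int[P]_w transition f (iterated m.+1 n x w))%E.
Proof.
move=> mf f0.
apply: (@integral_independent _ _ _ P _ _ P' _ E _ S (Z m)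
   (iterated m.+1 n x) Z' (fun z => f (g z.1 z.2))) => //.
- exact: independent_iterated.
- exact: measurableT_comp mg.
Qed.

(** Peeling off the outermost map applies the operator once. The result does not involve [m], so
    this takes the place of shift invariance of the sequence. *)
Lemma integral_iterated_shift m n x f :
    measurable_fun setT f -> (forall y, 0 <= f y)%E ->
  (\int[P]_w f (iterated m n x w) = iter n transition f x)%E.
Proof.
elim: n m f => [|n IH] m f mf f0 /=.
  exact: integral_prob_cst.
rewrite integral_iteratedS// IH -?iterSr//.
- exact: measurable_transition.
- exact: transition_ge0.
Qed.

(** The peeled map leaves iterates that start at [m.+1]; as expectations do not depend on the first
    index, they may start at [m] again. This turns the backward iterates into a Markov recursion in
    [n]. *)
Lemma integral_iterated_transition m n x f :
    measurable_fun setT f -> (forall y, 0 <= f y)%E ->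
  (\int[P]_w f (iterated m n.+1 x w) =
   \int[P]_w transition f (iterated m n x w))%E.
Proof.
move=> mf f0; rewrite (integral_iterated_shift _ _ _ mf f0) iterSr.
rewrite integral_iterated_shift//; last exact: transition_ge0.
exact: measurable_transition.
Qed.

End iterated.

(** * Inequalities for real powers *)

Section power_inequalities.
Context {R : realType}.
Implicit Types x y u v t s alpha kappa : R.

Lemma ler_powRl x y s : 0 <= s -> 0 <= x -> x <= y -> x `^ s <= y `^ s.
Proof. by move=> s0 x0 xy; rewrite ge0_ler_powR// nnegrE// (le_trans x0). Qed.

(** Either y <= delta x or x < y / delta. The factor of the first power can be brought as close to 1
    as desired, which preserves a contraction, and no distinction between s < 1 and s >= 1
    arises. *)
Lemma powR_addl_le x y s delta : 0 <= x -> 0 <= y -> 0 < delta -> 0 <= s ->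
  (x + y) `^ s <= (1 + delta) `^ s * x `^ s + (1 + delta^-1) `^ s * y `^ s.
Proof.
move=> x0 y0 d0 s0.
have [yx|xy] := leP y (delta * x).
- rewrite -[leLHS]addr0 lerD// ?mulr_ge0 ?powR_ge0//.
  rewrite -powRM ?(addr_ge0 ler01 (ltW d0))//.
  by apply: ler_powRl; rewrite ?addr_ge0// mulrDl mul1r lerD2l.
- rewrite -[leLHS]add0r lerD// ?mulr_ge0 ?powR_ge0//.
  have dV0 : 0 <= delta^-1 by rewrite invr_ge0 ltW.
  rewrite -powRM// ?addr_ge0//.
  apply: ler_powRl; rewrite ?addr_ge0// mulrDl mul1r addrC lerD2l.
  by rewrite mulrC ler_pdivlMr// mulrC ltW.
Qed.

Lemma bernoulli_le t n : 0 <= t <= 1 -> 1 - t ^+ n <= n%:R * (1 - t).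
Proof.
move=> /andP[t0 t1]; elim: n => [|n IH]; first by rewrite expr0 subrr mul0r.
have n0 : 0 <= n%:R * (1 - t) by rewrite mulr_ge0// subr_ge0.
rewrite exprS -natr1 mulrDl mul1r.
have : t * (1 - t ^+ n) <= 1 * (n%:R * (1 - t)).
  by rewrite ler_pM// subr_ge0 exprn_ile1.
by rewrite mul1r => ?; lra.
Qed.

(** On [0, 1] the power of order [alpha] is at least that of any integer order above [alpha], to
    which Bernoulli's inequality applies. *)
Lemma powR_bernoulli_le alpha : 0 < alpha ->
  exists2 N : R, 0 <= N & forall t, 0 <= t <= 1 -> 1 - t `^ alpha <= N * (1 - t).
Proof.
move=> a0; have aN := archi_boundP (ltW a0).
exists (Num.bound alpha)%:R => // t /andP[t0 t1].
apply: le_trans (bernoulli_le (Num.bound alpha) _); last by rewrite t0.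
rewrite lerD2l lerN2; have [->|t_neq0] := eqVneq t 0.
  have : (0 < Num.bound alpha)%N by rewrite -(@ltr_nat R) (lt_trans a0).
  by case: (Num.bound alpha) => // n _; rewrite expr0n powR_ge0.
by rewrite -powR_mulrn// ger_powR ?lt_neqAle 1?eq_sym ?t_neq0 ?t0//= ltW.
Qed.

(** By homogeneity only t = v / u matters, and 1 - t <= (1 - t)^kappa because 1 - t lies in [0, 1]
    and kappa <= 1. The constant is independent of [kappa]. *)
Lemma powR_sub_le alpha : 0 < alpha ->
  exists2 N : R, 0 <= N & forall kappa u v, 0 <= kappa <= 1 -> 0 <= v <= u ->
    u `^ alpha - v `^ alpha <= N * ((u - v) `^ kappa * u `^ (alpha - kappa)).
Proof.
move=> a0; have [N N0 HN] := powR_bernoulli_le a0.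
exists N => // kappa u v /andP[k0 k1] /andP[v0 vu].
have u0 : 0 <= u by exact: le_trans vu.
have [uE|u_neq0] := eqVneq u 0.
  have -> : v = 0 by apply/eqP; rewrite eq_le v0 andbT -uE.
  by rewrite uE powR0 ?gt_eqF// subrr !mulr_ge0 ?powR_ge0.
have u_gt0 : 0 < u by rewrite lt_neqAle eq_sym u_neq0.
have t0 : 0 <= v / u by rewrite divr_ge0.
have t1 : v / u <= 1 by rewrite ler_pdivrMr// mul1r.
have -> : v `^ alpha = u `^ alpha * (v / u) `^ alpha.
  by rewrite -powRM// mulrCA divff// mulr1.
have -> : u `^ alpha - u `^ alpha * (v / u) `^ alpha =
  u `^ alpha * (1 - (v / u) `^ alpha) by ring.
apply: (@le_trans _ _ (u `^ alpha * (N * (1 - v / u) `^ kappa))).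
  rewrite ler_wpM2l ?powR_ge0//.
  rewrite (le_trans (HN _ _)) ?t0// ler_wpM2l//.
  have [e|e] := eqVneq (1 - v / u) 0; first by rewrite e powR_ge0.
  have e_gt0 : 0 < 1 - v / u by rewrite lt_neqAle eq_sym e subr_ge0.
  by apply: ger1_powR => //; rewrite e_gt0 lerBlDr lerDl.
have -> : u - v = u * (1 - v / u) by rewrite mulrBr mulr1 mulrCA divff// mulr1.
rewrite powRM ?subr_ge0//.
rewrite powRB ?u_neq0 ?implybT//.
have : u `^ kappa != 0 by rewrite gt_eqF ?powR_gt0.
move=> uk; rewrite le_eqVlt; apply/orP; left; apply/eqP.
by field.
Qed.

(** The function [p] stands for the positive or the negative part. The larger of [p u] and
    [p (u + b)] takes the role of the larger argument in [powR_sub_le]. *)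
Lemma lipschitz_powR_sub_le alpha (p : R -> R) : 0 < alpha ->
    (forall u, 0 <= p u <= `|u|) ->
    (forall u v, `|p u - p v| <= `|u - v|) ->
  exists2 N : R, 0 <= N & forall kappa u b, 0 <= kappa <= 1 -> kappa <= alpha ->
    `|p (u + b) `^ alpha - p u `^ alpha| <=
    N * (`|b| `^ kappa * (`|u| + `|b|) `^ (alpha - kappa)).
Proof.
move=> a0 p0 plip; have [N N0 HN] := powR_sub_le a0.
exists N => // kappa u b k01 ka.
have k0 : 0 <= kappa by case/andP: k01.
suff H v w : p v <= p w -> `|w - v| <= `|b| -> `|w| <= `|u| + `|b| ->
    `|p w `^ alpha - p v `^ alpha| <=
    N * (`|b| `^ kappa * (`|u| + `|b|) `^ (alpha - kappa)).
  have [le|/ltW le] := leP (p u) (p (u + b)).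
  - by apply: H => //; rewrite ?ler_normD// addrAC subrr add0r.
  - rewrite distrC; apply: H => //; last by rewrite lerDl.
    by rewrite opprD addrA subrr add0r normrN.
move=> pvw wv wub; have /andP[pv0 _] := p0 v; have /andP[pw0 pw1] := p0 w.
rewrite ger0_norm; last first.
  by rewrite subr_ge0 ler_powRl// ltW.
rewrite (le_trans (HN kappa _ _ _ _)) ?pv0//.
rewrite ler_wpM2l// ler_pM ?powR_ge0//.
  apply: ler_powRl; rewrite ?subr_ge0//.
  by rewrite (le_trans _ wv)// (le_trans _ (plip w v))// ler_norm.
apply: ler_powRl; rewrite ?subr_ge0//.
exact: le_trans wub.
Qed.

(** This is the previous bound with kappa = alpha - s; the condition alpha <= s + 1 says kappa <= 1.
    The coefficients separate from [y], so that the former need only moments of order [alpha] and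
    the latter only one of order [s]. *)
Lemma affine_powR_sub_le alpha s (p : R -> R) : 0 < alpha -> 0 <= s ->
    s <= alpha <= s + 1 ->
    (forall u, 0 <= p u <= `|u|) ->
    (forall u v, `|p u - p v| <= `|u - v|) ->
  exists2 K : R, 0 <= K & forall a b y,
    `|p (a * y + b) `^ alpha - p (a * y) `^ alpha| <=
    K * ((`|a| `^ alpha + `|b| `^ alpha) * (1 + `|y| `^ s)).
Proof.
move=> a0 s0 /andP[sa as1] p0 plip.
have [N N0 HN] := lipschitz_powR_sub_le a0 p0 plip.
exists (N * 2 `^ s) => [|a b y]; first by rewrite mulr_ge0 ?powR_ge0.
pose kappa := alpha - s.
have k0 : 0 <= kappa by rewrite subr_ge0.
have k1 : kappa <= 1 by rewrite lerBlDr addrC.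
have aks : alpha - kappa = s by rewrite /kappa opprB addrC subrK.
have ska : s + kappa = alpha by rewrite /kappa addrC subrK.
have ka : kappa <= alpha by rewrite lerBlDr lerDl.
have k01 : 0 <= kappa <= 1 by rewrite k0.
apply: le_trans (HN _ _ _ k01 ka) _; rewrite aks -mulrA.
rewrite ler_wpM2l// normrM.
have := @powR_addl_le (`|a| * `|y|) `|b| s 1.
rewrite ltr01 invr1 s0 !normr_ge0 mulr_ge0// => /(_ isT isT isT isT).
have -> : 1 + 1 = 2 :> R by [].
rewrite -mulrDr powRM// => H.
apply: (@le_trans _ _ (`|b| `^ kappa *
  (2 `^ s * (`|a| `^ s * `|y| `^ s + `|b| `^ s)))).
  by rewrite ler_wpM2l// powR_ge0.
rewrite mulrCA ler_wpM2l ?powR_ge0//.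
have pD x : x `^ kappa * x `^ s = x `^ alpha.
  rewrite mulrC -powRD ?ska//; apply/implyP; rewrite gt_eqF//.
(* Since kappa + s = alpha, the larger of |a| and |b|, raised to the order alpha, bounds the mixed
   product. *)
have ab : `|b| `^ kappa * `|a| `^ s <= `|a| `^ alpha + `|b| `^ alpha.
  have [ab|/ltW ba] := leP `|a| `|b|.
  - rewrite -[leLHS]add0r lerD ?powR_ge0// -pD ler_wpM2l ?powR_ge0//.
    exact: ler_powRl.
  - rewrite -[leLHS]addr0 lerD ?powR_ge0// -pD ler_wpM2r ?powR_ge0//.
    exact: ler_powRl.
have y0 : 0 <= `|y| `^ s by rewrite powR_ge0.
rewrite mulrDr pD mulrA mulrDr mulr1 addrC lerD//.
  by rewrite lerDr powR_ge0.
by rewrite ler_wpM2r.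
Qed.

(* Young's inequality with a quadratic remainder, obtained by applying the plain
   inequality to [Num.sqrt (x `^ alpha)] and squaring. *)
Lemma powR_young_strict x alpha s : 0 <= x -> 0 < s < alpha ->
  x `^ s + (s / alpha) * (1 - s / alpha) * (x `^ (alpha / 2) - 1) ^+ 2 <=
  (s / alpha) * x `^ alpha + (1 - s / alpha).
Proof.
move=> x0 /andP[s0 sa]; have a0 : 0 < alpha by exact: lt_trans sa.
set th := s / alpha; set w := x `^ (alpha / 2).
have th0 : 0 < th by rewrite divr_gt0.
have th1 : th < 1 by rewrite ltr_pdivrMr// mul1r.
have w0 : 0 <= w by exact: powR_ge0.
have xa : x `^ alpha = w ^+ 2.
  by rewrite -powR_mulrn// -powRrM divfK.
have xs : x `^ s = (w `^ th) ^+ 2.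
  rewrite -powR_mulrn ?powR_ge0// -!powRrM; congr (_ `^ _).
  by rewrite /th; field; rewrite gt_eqF.
have wth : w `^ th <= th * w + (1 - th).
  have p0 : 0 < th^-1 by rewrite invr_gt0.
  have q0 : 0 < (1 - th)^-1 by rewrite invr_gt0 subr_gt0.
  have pq : th^-1^-1 + (1 - th)^-1^-1 = 1 by rewrite !invrK addrC subrK.
  have := conjugate_powR (powR_ge0 w th) ler01 p0 q0 pq; rewrite !invrK.
  by rewrite -powRrM divff ?gt_eqF// powRr1// mulr1 powR1 mul1r mulrC.
have : (w `^ th) ^+ 2 <= (th * w + (1 - th)) ^+ 2.
  apply: lerXn2r => //; rewrite nnegrE ?powR_ge0//.
  by apply: addr_ge0; [rewrite mulr_ge0// ltW|rewrite subr_ge0 ltW].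
rewrite xa xs => H; nra.
Qed.

End power_inequalities.

(** * Averages of perturbed linear recursions *)

Section averages.
Context {R : realType}.
Implicit Types (u d delta eps : nat -> R) (l r : R).

Lemma cvg_sum_average delta l : delta n @[n --> \oo] --> l ->
  n%:R^-1 * (\sum_(0 <= k < n) delta k) @[n --> \oo] --> l.
Proof.
move=> /cesaro; rewrite -[X in _ -> X]cvg_shiftS; apply: cvg_trans.
by apply: near_eq_cvg; near=> n; rewrite /arithmetic_mean/=.
Unshelve. all: by end_near. Qed.

Lemma cvg_natV : (n%:R^-1 : R) @[n --> \oo] --> (0 : R).
Proof. by rewrite -cvg_shiftS; exact: cvg_harmonic. Qed.

Lemma cvg_average_rec u delta l : (forall n, u n.+1 = u n + delta n) ->
  delta n @[n --> \oo] --> l -> n%:R^-1 * u n @[n --> \oo] --> l.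
Proof.
move=> uS dl.
have uE n : u n = u 0%N + \sum_(0 <= k < n) delta k.
  elim: n => [|n IH]; first by rewrite big_geq// addr0.
  by rewrite big_nat_recr//= uS IH addrA.
under eq_fun do rewrite uE mulrDr.
rewrite -(add0r l); apply: cvgD; last exact: cvg_sum_average.
rewrite -[X in _ --> X](mul0r (u 0%N)); apply: cvgM; last exact: cvg_cst.
exact: cvg_natV.
Qed.

(* Around the fixed point [c = r * c + l], the recursion only adds the errors
   [`|eps k - l|], whose averages vanish. *)
Lemma cvg_average_contraction d eps r l : `|r| <= 1 -> r != 1 ->
    (forall n, d n.+1 = r * d n + eps n) -> eps n @[n --> \oo] --> l ->
  n%:R^-1 * d n @[n --> \oo] --> (0 : R).
Proof.
move=> r1 rn1 dS epsl.
have r1' : 1 - r != 0 by rewrite subr_eq0 eq_sym.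
pose c := l / (1 - r).
have cE : c = r * c + l by rewrite /c; field.
pose e n := d n - c.
have eS n : `|e n.+1| <= `|e n| + `|eps n - l|.
  have -> : e n.+1 = r * e n + (eps n - l) by rewrite /e dS {1}cE; ring.
  rewrite (le_trans (ler_normD _ _))// lerD2r normrM.
  by rewrite ler_piMl.
have eB n : `|e n| <= `|e 0%N| + \sum_(0 <= k < n) `|eps k - l|.
  elim: n => [|n IH]; first by rewrite big_geq ?addr0.
  by rewrite big_nat_recr//= addrA (le_trans (eS n))// lerD2r.
have bound : n%:R^-1 * (`|c| + `|e 0%N| + \sum_(0 <= k < n) `|eps k - l|)
    @[n --> \oo] --> (0 : R).
  rewrite -[X in _ --> X]addr0; under eq_fun do rewrite mulrDr.
  apply: cvgD.
    rewrite -[X in _ --> X](mul0r (`|c| + `|e 0%N|)).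
    by apply: cvgM; [exact: cvg_natV|exact: cvg_cst].
  apply: (@cvg_sum_average (fun k => `|eps k - l|)).
  rewrite -[X in _ --> X](@normr0 _ R); apply: cvg_norm.
  by rewrite -[X in _ --> X](subrr l); apply: cvgB => //; exact: cvg_cst.
apply/cvgr0Pnorm_lt => eps' e0.
move/cvgr0Pnorm_lt : bound => /(_ _ e0); apply: filterS => n.
apply: le_lt_trans; rewrite normrM [leRHS]normrM ler_wpM2l// [leRHS]ger0_norm; last first.
  by rewrite !addr_ge0// sumr_ge0.
have -> : d n = c + e n by rewrite /e addrC subrK.
by rewrite (le_trans (ler_normD _ _))// -addrA lerD2l.
Qed.

End averages.

Lemma measurable_norm_powR {R : realType} d (T : measurableType d) (f : T -> R) (s : R) :
  measurable_fun setT f -> measurable_fun setT (fun w => (`|f w| `^ s)%:E).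
Proof.
move=> mf; apply/measurable_EFinP.
apply: (measurableT_comp (measurable_powR s)).
exact: measurableT_comp.
Qed.

(** * Moments of affine iterations *)

Section affine_iteration.
Context {R : realType} d (T : measurableType d) (P : probability T R).
Context d1 (E : measurableType d1).
Variable Z : nat -> {mfun T >-> E}.

Definition affine (a b : E -> R) (z : E) (y : R) : R := a z * y + b z.

Lemma measurable_affine (a b : E -> R) :
  measurable_fun setT a -> measurable_fun setT b ->
  measurable_fun setT (fun x : E * R => affine a b x.1 x.2).
Proof.
move=> ma mb; apply: measurable_funD; last exact: measurableT_comp.
by apply: measurable_funM => //; exact: measurableT_comp.
Qed.

Lemma iterated_affineE a b m n x w : iterated Z (affine a b) m n x w =
  \sum_(0 <= i < n) (\prod_(0 <= j < i) a (Z (m + j)%N w)) * b (Z (m + i)%N w) +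
  (\prod_(0 <= j < n) a (Z (m + j)%N w)) * x.
Proof.
elim: n m => [|n IH] m /=; first by rewrite !big_geq// add0r mul1r.
rewrite IH /affine big_nat_recl//= [in RHS]big_nat_recl//= addn0.
rewrite [X in X * b _]big_geq// mul1r.
have -> : \prod_(0 <= i < n) a (Z (m + i.+1)%N w) =
    \prod_(0 <= j < n) a (Z (m.+1 + j)%N w).
  by apply: eq_bigr => j _; rewrite addSnnS.
have -> : \sum_(0 <= i < n) (\prod_(0 <= j < i.+1) a (Z (m + j)%N w)) *
      b (Z (m + i.+1)%N w) =
    a (Z m w) * \sum_(0 <= i < n) (\prod_(0 <= j < i) a (Z (m.+1 + j)%N w)) *
      b (Z (m.+1 + i)%N w).
  rewrite mulr_sumr; apply: eq_bigr => i _.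
  rewrite [in LHS]big_nat_recl//= addn0 -mulrA addSnnS; congr (_ * (_ * _)).
  by apply: eq_bigr => j _; rewrite addSnnS.
ring.
Qed.

Hypothesis indepZ : mutual_independence P (fun n => Z n : T -> E).
Context d' (T' : measurableType d') (P' : probability T' R).
Variable Z' : {mfun T' >-> E}.
Hypothesis lawZ : forall n, same_law P P' (Z n) Z'.

Section moments.
Variables (g : E -> R -> R) (a b : E -> R).
Hypothesis mg : measurable_fun setT (fun x : E * R => g x.1 x.2).
Hypotheses (ma : measurable_fun setT a) (mb : measurable_fun setT b).
Hypotheses (a0 : forall z, 0 <= a z) (b0 : forall z, 0 <= b z).
Hypothesis gab : forall z y, `|g z y| <= a z * `|y| + b z.
Variables (s phi beta : R).
Hypotheses (s_gt0 : 0 < s) (phi0 : 0 <= phi) (beta0 : 0 <= beta).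
Hypothesis a_moment : (\int[P']_w (`|a (Z' w)| `^ s)%:E <= phi%:E)%E.
Hypothesis b_moment : (\int[P']_w (`|b (Z' w)| `^ s)%:E <= beta%:E)%E.

Let f (y : R) : \bar R := (`|y| `^ s)%:E.

Let mf : measurable_fun setT f.
Proof. exact: measurable_norm_powR. Qed.

Let f0 y : (0 <= f y)%E.
Proof. by rewrite lee_fin powR_ge0. Qed.

Let mitf m n x : measurable_fun setT (fun w => f (iterated Z g m n x w)).
Proof. exact: (measurableT_comp mf (measurable_iterated Z mg m n x)). Qed.

Lemma transition_powR_le delta y : 0 < delta ->
  (transition g P' Z' f y <=
   ((1 + delta) `^ s * phi)%:E * f y + ((1 + delta^-1) `^ s * beta)%:E)%E.
Proof.
move=> d0; rewrite /transition.
have c0 t : 0 <= (1 + t) `^ s by exact: powR_ge0.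
have mZa : measurable_fun setT (fun w => (`|a (Z' w)| `^ s)%:E).
  by apply: measurable_norm_powR; exact: measurableT_comp.
have mZb : measurable_fun setT (fun w => (`|b (Z' w)| `^ s)%:E).
  by apply: measurable_norm_powR; exact: measurableT_comp.
have fy : (0 <= ((1 + delta) `^ s)%:E * f y)%E by rewrite mule_ge0// lee_fin.
apply: (@le_trans _ _ (\int[P']_w
   ((((1 + delta) `^ s)%:E * f y) * (`|a (Z' w)| `^ s)%:E +
     ((1 + delta^-1) `^ s)%:E * (`|b (Z' w)| `^ s)%:E))%E).
  apply: ge0_le_integral => //.
  - have mp : measurable_fun setT (fun w => (Z' w, y)).
      exact: measurable_fun_pair.
    exact: (measurableT_comp mf (measurableT_comp mg mp)).
  - apply: emeasurable_funD; apply: measurable_funeM => //.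
  - move=> w _; rewrite /f -!EFinM -EFinD lee_fin.
    apply: (@le_trans _ _ ((a (Z' w) * `|y| + b (Z' w)) `^ s)).
      exact: ler_powRl (ltW s_gt0) _ (gab _ _).
    rewrite (le_trans (powR_addl_le _ _ d0 (ltW s_gt0))) ?mulr_ge0//.
    rewrite (ger0_norm (a0 _)) (ger0_norm (b0 _)) powRM//.
    by rewrite [a _ `^ s * _]mulrC mulrA.
rewrite ge0_integralD//; last 4 first.
- by move=> w _; rewrite mule_ge0// lee_fin powR_ge0.
- exact: measurable_funeM.
- by move=> w _; rewrite mule_ge0// lee_fin// powR_ge0.
- exact: measurable_funeM.
rewrite ge0_integralZl//.
rewrite ge0_integralZl//; last by rewrite lee_fin.
apply: leeD.
  by rewrite [in leRHS]EFinM [leRHS]muleAC lee_wpmul2l.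
by rewrite EFinM lee_wpmul2l// lee_fin.
Qed.

Lemma integral_iterated_powR_rec delta n x : 0 < delta ->
  (\int[P]_w f (iterated Z g 0 n.+1 x w) <=
   ((1 + delta) `^ s * phi)%:E * \int[P]_w f (iterated Z g 0 n x w) +
   ((1 + delta^-1) `^ s * beta)%:E)%E.
Proof.
move=> d0; rewrite (integral_iterated_transition mg indepZ lawZ)//.
have c0 : (0 <= ((1 + delta) `^ s * phi)%:E)%E by rewrite lee_fin mulr_ge0// powR_ge0.
have c0' : (0 <= ((1 + delta^-1) `^ s * beta)%:E)%E.
  by rewrite lee_fin mulr_ge0// powR_ge0.
apply: (@le_trans _ _ (\int[P]_w
   (((1 + delta) `^ s * phi)%:E * f (iterated Z g 0 n x w) +
    ((1 + delta^-1) `^ s * beta)%:E))%E).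
  apply: ge0_le_integral => //.
  - by move=> w _; exact: transition_ge0.
  - apply: measurableT_comp (measurable_iterated Z mg _ _ _).
    exact: (measurable_transition mg).
  - by apply: emeasurable_funD => //; exact: measurable_funeM.
  - by move=> w _; exact: transition_powR_le.
rewrite ge0_integralD//; last 2 first.
- by move=> w _; rewrite mule_ge0.
- exact: measurable_funeM.
by rewrite ge0_integralZl// integral_prob_cst.
Qed.

(** Finite for each [n], not uniformly: no upper bound is imposed on [phi], so that the order alpha,
    where [phi = 1], is covered. *)
Lemma integral_iterated_powR_lty n x :
  (\int[P]_w f (iterated Z g 0 n x w) < +oo)%E.
Proof.
elim: n => [|n IH]; first by rewrite /= integral_prob_cst ltry.
apply: le_lt_trans (integral_iterated_powR_rec n x ltr01) _.
have : (\int[P]_w f (iterated Z g 0 n x w))%E \is a fin_num.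
  by rewrite ge0_fin_numE// integral_ge0.
by move=> /fineK <-; rewrite -EFinM -EFinD ltry.
Qed.

Lemma integral_iterated_powR_bounded : phi < 1 ->
  exists C : R, forall n, (\int[P]_w f (iterated Z g 0 n 0%R w) <= C%:E)%E.
Proof.
move=> phi1; pose phi' := (phi + 1) / 2.
have [phiphi' phi'1] : phi < phi' /\ phi' < 1.
  by have [] := midf_lt phi1.
have phi'0 : 0 < phi' by exact: le_lt_trans phiphi'.
pose delta := phi'^-1 `^ s^-1 - 1.
have d0 : 0 < delta.
  rewrite subr_gt0 -[ltLHS](_ : 1 `^ s^-1 = 1); last by rewrite powR1.
  apply: gt0_ltr_powR; rewrite ?nnegrE ?invr_gt0 ?invr_ge0 ?invf_gt1//.
  exact: ltW.
have dE : (1 + delta) `^ s = phi'^-1.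
  rewrite /delta addrC subrK -powRrM mulVf ?gt_eqF// powRr1//.
  by rewrite invr_ge0 ltW.
pose r := phi'^-1 * phi; pose c := (1 + delta^-1) `^ s * beta.
have r0 : 0 <= r by rewrite mulr_ge0// invr_ge0 ltW.
have r1 : r < 1 by rewrite /r mulrC ltr_pdivrMr// mul1r.
have c0 : 0 <= c by rewrite mulr_ge0// powR_ge0.
have rc : 0 <= c / (1 - r) by rewrite divr_ge0// subr_ge0 ltW.
(* The fixed point of t -> r t + c; the recursion starts at 0, below it, and so never exceeds it. *)
exists (c / (1 - r)); elim=> [|n IH].
  by rewrite /= integral_prob_cst /f normr0 powR0 ?gt_eqF// lee_fin.
apply: le_trans (integral_iterated_powR_rec n 0 d0) _; rewrite dE -/r -/c.
apply: (@le_trans _ _ (r%:E * (c / (1 - r))%:E + c%:E)%E).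
  by rewrite leeD2r// lee_wpmul2l// lee_fin.
rewrite -EFinM -EFinD lee_fin le_eqVlt; apply/orP; left; apply/eqP.
by field; rewrite gt_eqF// subr_gt0.
Qed.

End moments.
End affine_iteration.

(** The summand 1 next to |B i| makes the products themselves summable. They therefore tend to 0,
    and the starting point [x] is forgotten. *)
Lemma affine_sum_cvg {R : realType} (A B : nat -> R) (M : R) :
    (forall n, \sum_(0 <= i < n) (\prod_(0 <= j < i) `|A j|) * (`|B i| + 1) <= M) ->
  exists l : R, forall x : R,
    \sum_(0 <= i < n) (\prod_(0 <= j < i) A j) * B i +
    (\prod_(0 <= j < n) A j) * x @[n --> \oo] --> l.
Proof.
move=> HM.
pose v i := (\prod_(0 <= j < i) `|A j|) * (`|B i| + 1).
have p0 i : 0 <= \prod_(0 <= j < i) `|A j| by exact: prodr_ge0.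
have v0 i : 0 <= v i by rewrite mulr_ge0// addr_ge0.
have cv : cvgn (series v).
  apply: nondecreasing_is_cvgn; last by exists M => _ [n _ <-]; exact: HM.
  by apply: nondecreasing_series => n _ _; exact: v0.
have cp : \prod_(0 <= j < n) A j @[n --> \oo] --> (0 : R).
  apply/norm_cvg0P.
  have : cvgn (series (fun n => `|\prod_(0 <= j < n) A j|)).
    apply: series_le_cvg cv => // n.
    by rewrite normr_prod /v ler_peMr// lerDr.
  by move/cvg_series_cvg_0.
have cs : cvgn (series (fun i => (\prod_(0 <= j < i) A j) * B i)).
  apply: normed_cvg; apply: series_le_cvg cv => //= n.
  by rewrite normrM normr_prod /v ler_wpM2l// lerDl.
exists (limn (series (fun i => (\prod_(0 <= j < i) A j) * B i))) => x.
rewrite -[X in _ --> X]addr0; apply: cvgD; first exact: cs.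
by rewrite -[X in _ --> X](mul0r x); apply: cvgM => //; exact: cvg_cst.
Qed.

(** * Almost sure limit and integrable majorant of the iterates *)

Section perpetuity.
Context {R : realType} d (T : measurableType d) (P : probability T R).
Context d1 (E : measurableType d1).
Variable Z : nat -> {mfun T >-> E}.
Hypothesis indepZ : mutual_independence P (fun n => Z n : T -> E).
Context d' (T' : measurableType d') (P' : probability T' R).
Variable Z' : {mfun T' >-> E}.
Hypothesis lawZ : forall n, same_law P P' (Z n) Z'.
Variables (a b : E -> R).
Hypotheses (ma : measurable_fun setT a) (mb : measurable_fun setT b).

(** The recursion with coefficients |a| and |b| + 1 started at 0 increases with [n], and its moments
    of order [s] are bounded. Its increasing limit gives [G], integrable by monotone convergence,
    hence finite almost everywhere, and finiteness of [G] at [w] forces convergence at [w]. *)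
Lemma perpetuity_limit (s phi beta : R) : 0 < s -> 0 <= phi < 1 -> 0 <= beta ->
    (\int[P']_w (`|a (Z' w)| `^ s)%:E <= phi%:E)%E ->
    (\int[P']_w ((`|b (Z' w)| + 1) `^ s)%:E <= beta%:E)%E ->
  exists (G : T -> \bar R) (Xinf : T -> R),
    [/\ P.-integrable setT G, measurable_fun setT Xinf,
     {ae P, forall w x, iterated Z (affine a b) 0 n x w @[n --> \oo] --> Xinf w} &
     forall w n, ((`|iterated Z (affine a b) 0 n 0%R w| `^ s)%:E <= G w)%E].
Proof.
move=> s0 /andP[phi0 phi1] beta0 aphi bbeta.
pose a' z := `|a z|; pose b' z := `|b z| + 1.
have ma' : measurable_fun setT a' by exact: measurableT_comp.
have mb' : measurable_fun setT b'.
  by apply: measurable_funD => //; exact: measurableT_comp.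
have mg := measurable_affine ma mb.
have mg' := measurable_affine ma' mb'.
pose W n x w := iterated Z (affine a b) 0 n x w.
pose V n w := iterated Z (affine a' b') 0 n (0 : R) w.
have VE n w : V n w = \sum_(0 <= i < n)
    (\prod_(0 <= j < i) `|a (Z j w)|) * (`|b (Z i w)| + 1).
  by rewrite /V iterated_affineE mulr0 addr0.
have V0 n w : 0 <= V n w.
  by rewrite VE sumr_ge0// => i _; rewrite mulr_ge0 ?prodr_ge0// addr_ge0.
have Vnd w : {homo V ^~ w : m n / (m <= n)%N >-> m <= n}.
  apply/nondecreasing_seqP => n; rewrite !VE big_nat_recr//= lerDl.
  by rewrite mulr_ge0 ?prodr_ge0// addr_ge0.
have WV n w : `|W n 0 w| <= V n w.
  rewrite /W iterated_affineE mulr0 addr0 VE (le_trans (ler_norm_sum _ _ _))//.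
  apply: ler_sum => i _; rewrite normrM normr_prod ler_wpM2l ?prodr_ge0//.
  by rewrite lerDl.
pose g n w := (`|V n w| `^ s)%:E.
have g0 n w : (0 <= g n w)%E by rewrite lee_fin powR_ge0.
have mgn n : measurable_fun setT (g n).
  exact/measurable_norm_powR/(measurable_iterated Z mg').
have gnd w : {homo g ^~ w : m n / (m <= n)%N >-> (m <= n)%E}.
  move=> m n mn; rewrite lee_fin; apply: ler_powRl (ltW s0) (normr_ge0 _) _.
  by rewrite !ger0_norm//; exact: Vnd.
pose G w := limn (g ^~ w).
have gcvg w : g ^~ w @ \oo --> G w.
  exact: ereal_nondecreasing_is_cvgn.
have gG n w : (g n w <= G w)%E.
  by apply: lime_ge; [exact: gcvg|near=> m; apply: gnd; near: m; exists n].
have mG : measurable_fun setT G.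
  by apply: (emeasurable_fun_cvg g) => // w _; exact: gcvg.
have G0 w : (0 <= G w)%E by exact: le_trans (gG 0%N w).
have iG : P.-integrable setT G.
  apply/integrableP; split => //.
  under eq_integral do rewrite gee0_abs//.
  have b'E z : `|b' z| = `|b z| + 1 by rewrite ger0_norm// addr_ge0.
  have [||z y|||C HC] := @integral_iterated_powR_bounded _ _ _ P _ _ Z indepZ
      _ _ P' Z' lawZ _ _ _ mg' ma' mb' _ _ _ s phi beta s0 phi0 beta0 _ _ phi1.
  - by move=> z; rewrite /a'.
  - by move=> z; rewrite /b' addr_ge0.
  - rewrite /affine (le_trans (ler_normD _ _))// normrM /a' /b' normr_id.
    by rewrite [X in _ + X]ger0_norm// addr_ge0.
  - by under eq_integral do rewrite /a' normr_id.
  - by under eq_integral do rewrite b'E.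
  apply: (@le_lt_trans _ _ C%:E); last exact: ltry.
  rewrite [leLHS](_ : _ = limn (fun n => \int[P]_w g n w))%E; last first.
    by apply: monotone_convergence => // w _; exact: gnd.
  apply: lime_le; last by apply: nearW => n; exact: HC.
  apply: ereal_nondecreasing_is_cvgn => m n mn.
  by apply: ge0_le_integral => // w _; exact: gnd.
(* The upper limit is measurable on the whole space and coincides with the limit wherever the
   iterates converge. *)
pose Xinf w := fine (limn_esup (fun n => (W n 0 w)%:E)).
exists G, Xinf; split => //.
- apply: measurableT_comp; first exact: fine_measurable.
  apply: measurable_fun_limn_esup => n; apply/measurable_EFinP.
  exact: (measurable_iterated Z mg).
- apply: filterS (integrable_ae measurableT iG) => w /(_ Logic.I) Gw.
  (* As [G] dominates the power of order [s] of every sum, its root of order [s] bounds the sums. *)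
  have [|l Hl] := @affine_sum_cvg R (fun i => a (Z i w)) (fun i => b (Z i w))
      (fine (G w) `^ s^-1).
    move=> n; rewrite -VE.
    have : `|V n w| `^ s <= fine (G w) by rewrite -lee_fin fineK//; exact: gG.
    have sV0 : 0 <= s^-1 by rewrite invr_ge0 ltW.
    move=> /(ler_powRl sV0 (powR_ge0 _ _)).
    by rewrite -powRrM mulfV ?gt_eqF// powRr1// ger0_norm.
  have Wl x : W n x w @[n --> \oo] --> l.
    by under eq_fun do rewrite /W iterated_affineE; exact: Hl.
  have -> : Xinf w = l; last exact: Wl.
  have Wl0 : (W n 0 w)%:E @[n --> \oo] --> l%:E.
    by apply: cvg_EFin; [exact: nearW|exact: Wl].
  rewrite /Xinf is_cvg_limn_esupE; last by apply/cvg_ex; exists l%:E.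
  by rewrite (cvg_lim _ Wl0).
- move=> w n; apply: le_trans (gG n w); rewrite lee_fin.
  apply: ler_powRl (ltW s0) (normr_ge0 _) _.
  by rewrite [leRHS]ger0_norm//; exact: WV.
Unshelve. all: by end_near. Qed.

End perpetuity.

Lemma integral_same_law {R : realType} d1 (T1 : measurableType d1)
    (P1 : probability T1 R) d2 (T2 : measurableType d2) (P2 : probability T2 R)
    d (E : measurableType d) (Y1 : {mfun T1 >-> E}) (Y2 : {mfun T2 >-> E})
    (f : E -> \bar R) :
    same_law P1 P2 Y1 Y2 -> measurable_fun setT f -> (forall x, 0 <= f x)%E ->
  (\int[P1]_w f (Y1 w) = \int[P2]_w f (Y2 w))%E.
Proof.
move=> Y12 mf f0.
rewrite -(@ge0_integral_distribution _ _ _ _ _ P1 Y1 f)//.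
rewrite -(@ge0_integral_distribution _ _ _ _ _ P2 Y2 f)//.
by apply: eq_measure_integral => A mA _; exact: Y12.
Qed.

(** * Identification of the stationary law with the law of the limit *)

Section stationary.
Context {R : realType} d (T : measurableType d) (P : probability T R).
Context d1 (E : measurableType d1).
Variable Z : nat -> {mfun T >-> E}.
Hypothesis indepZ : mutual_independence P (fun n => Z n : T -> E).
Context d' (T' : measurableType d') (P' : probability T' R).
Variable Z' : {mfun T' >-> E}.
Hypothesis lawZ : forall n, same_law P P' (Z n) Z'.
Variable (g : E -> R -> R).
Hypothesis mg : measurable_fun setT (fun x : E * R => g x.1 x.2).
Variable X : {mfun T' >-> R}.
Hypothesis indepX : independent2 P' Z' X.
Hypothesis lawX : same_law P' P' X (fun w => g (Z' w) (X w)).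

Lemma integral_stationary (f : R -> \bar R) :
    measurable_fun setT f -> (forall x, 0 <= f x)%E ->
  (\int[P']_w f (X w) = \int[P']_w transition g P' Z' f (X w))%E.
Proof.
move=> mf f0.
have mZX : measurable_fun setT (fun w => (Z' w, X w)).
  by apply: measurable_fun_pair.
have mgZX : measurable_fun setT (fun w => g (Z' w) (X w)).
  exact: (measurableT_comp mg mZX).
pose X' : {mfun T' >-> R} :=
  HB.pack (fun w => g (Z' w) (X w)) (isMeasurableFun.Build _ _ _ _ _ mgZX).
rewrite (@integral_same_law _ _ _ _ _ _ P' _ _ X X')//.
apply: (@integral_independent _ _ _ P' _ _ P' _ E _ _ Z' X Z'
   (fun z => f (g z.1 z.2))) => //.
exact: measurableT_comp mg.
Qed.

(** A chain started from the stationary law keeps it. The independent starting point is expressed by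
    a double integral over the two spaces. *)
Lemma integral_stationary_iterated n (f : R -> \bar R) :
    measurable_fun setT f -> (forall x, 0 <= f x)%E ->
  (\int[P']_w f (X w) = \int[P']_w' \int[P]_w f (iterated Z g 0 n (X w') w))%E.
Proof.
move=> mf f0.
under [RHS]eq_integral do rewrite (integral_iterated_shift mg indepZ lawZ)//.
elim: n f mf f0 => [//|n IH] f mf f0.
have mtf := measurable_transition mg P' Z' mf f0.
have tf0 := transition_ge0 g P' Z' f0.
rewrite (integral_stationary mf f0) (IH _ mtf tf0).
by apply: eq_integral => w _; rewrite iterSr.
Qed.

Variable Xinf : T -> R.
Hypothesis mXinf : measurable_fun setT Xinf.
Hypothesis cvgX :
  {ae P, forall w x, iterated Z g 0 n x w @[n --> \oo] --> Xinf w}.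

(** Iterates started at [X] keep its law, while almost surely they tend to [Xinf] from every
    starting point. Dominated convergence is applied first with the starting point fixed, then in
    the starting point. *)
Lemma integral_stationary_bounded (f : R -> R) (k : R) : continuous f ->
    (forall x, 0 <= f x <= k) ->
  (\int[P']_w (f (X w))%:E = \int[P]_w (f (Xinf w))%:E)%E.
Proof.
move=> cf fk.
have mf : measurable_fun setT (EFin \o f).
  by apply/measurable_EFinP; exact: continuous_measurable_fun.
have f0 x : (0 <= (f x)%:E)%E by rewrite lee_fin; case/andP: (fk x).
have fk' x : (`|(f x)%:E| <= k%:E)%E.
  by rewrite gee0_abs// lee_fin; case/andP: (fk x).
have ik d0 (T0 : measurableType d0) (P0 : probability T0 R) :
    P0.-integrable setT (fun=> k%:E).
  exact: (finite_measure_integrable_cst P0 k measurableT).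
have inner x : (\int[P]_w (f (iterated Z g 0 n x w))%:E)%E @[n --> \oo] -->
    (\int[P]_w (f (Xinf w))%:E)%E.
  have [] // := @dominated_convergence _ _ _ P setT measurableT
    (fun n w => (f (iterated Z g 0 n x w))%:E) (fun w => (f (Xinf w))%:E)
    (fun=> k%:E).
  - by move=> n; exact: (measurableT_comp mf (measurable_iterated Z mg _ _ _)).
  - exact: (measurableT_comp mf mXinf).
  - apply: filterS cvgX => w Hw _.
    apply: cvg_EFin; first exact: nearW.
    exact: (continuous_cvg _ (cf _) (Hw x)).
  - exact: ik.
  - by apply: aeW => w n _; exact: fk'.
have outer : (\int[P']_w' \int[P]_w (f (iterated Z g 0 n (X w') w))%:E)%E
    @[n --> \oo] --> (\int[P']_w' \int[P]_w (f (Xinf w))%:E)%E.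
  have [] // := @dominated_convergence _ _ _ P' setT measurableT
    (fun n w' => \int[P]_w (f (iterated Z g 0 n (X w') w))%:E)%E
    (fun w' => \int[P]_w (f (Xinf w))%:E)%E (fun=> k%:E).
  - move=> n.
    under eq_fun do rewrite (integral_iterated_shift mg indepZ lawZ 0 n _ mf f0).
    have H : measurable_fun setT (iter n (transition g P' Z') (EFin \o f)) /\
        forall x, (0 <= iter n (transition g P' Z') (EFin \o f) x)%E.
      elim: n => [//|n [IH1 IH2]] /=; split; last exact: transition_ge0.
      exact: (measurable_transition mg).
    exact: (measurableT_comp H.1).
  - by apply: aeW => w' _; exact: inner.
  - exact: ik.
  - apply: aeW => w' n _; rewrite gee0_abs ?integral_ge0//.
    apply: (@le_trans _ _ (\int[P]_w k%:E)%E); last by rewrite integral_prob_cst.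
    apply: ge0_le_integral => //.
    + exact: (measurableT_comp mf (measurable_iterated Z mg _ _ _)).
    + by move=> w _; rewrite lee_fin; case/andP: (fk (iterated Z g 0 n (X w') w)).
(* The constant sequence is rewritten as the sequence of double integrals, whose limit is known. *)
have : (\int[P']_w (f (X w))%:E)%E @[_ --> \oo] -->
    (\int[P']_w (f (X w))%:E)%E by exact: cvg_cst.
under eq_fun => n do rewrite (@integral_stationary_iterated n _ mf f0).
move=> /cvg_lim <- //.
by rewrite (cvg_lim _ outer)// integral_prob_cst.
Qed.

(** Truncation at height [k] and monotone convergence remove the bound on [f]. Both sides may be
    infinite, so the identity can be used to prove that a moment of [X] is finite. *)
Lemma integral_stationary_limit (f : R -> R) : continuous f ->
    (forall x, 0 <= f x) ->
  (\int[P']_w (f (X w))%:E = \int[P]_w (f (Xinf w))%:E)%E.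
Proof.
move=> cf f0.
pose fk (k : nat) x := Num.min (f x) k%:R.
have cfk k : continuous (fk k).
  move=> x; have := @continuous_min R R f (cst k%:R) x (cf x).
  by move=> /(_ (@cst_continuous R R k%:R x)).
have fk0 k x : 0 <= fk k x <= k%:R by rewrite le_min f0 ler0n ge_min lexx orbT.
have mfk k : measurable_fun setT (EFin \o fk k).
  by apply/measurable_EFinP; exact: continuous_measurable_fun.
have fknd x : {homo (fun k => (fk k x)%:E) : m n / (m <= n)%N >-> (m <= n)%E}.
  move=> m n mn; rewrite lee_fin /fk le_min ge_min lexx/=.
  by rewrite ge_min ler_nat mn orbT.
have fklim x : limn (fun k => (fk k x)%:E) = (f x)%:E.
  apply: lim_near_cst => //; near=> k; congr (_%:E); apply/min_idPl.
  near: k; exact: nbhs_infty_ger.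
have mono d0 (T0 : measurableType d0) (P0 : probability T0 R) (Y : T0 -> R) :
    measurable_fun setT Y ->
    (\int[P0]_w (f (Y w))%:E = limn (fun k => \int[P0]_w (fk k (Y w))%:E))%E.
  move=> mY; under eq_integral do rewrite -fklim.
  apply: monotone_convergence => //.
  - by move=> k; exact: (measurableT_comp (mfk k) mY).
  - by move=> k w _; rewrite lee_fin; case/andP: (fk0 k (Y w)).
rewrite !mono//; congr (limn _); apply/funext => k.
exact: integral_stationary_bounded (cfk k) (fk0 k).
Unshelve. all: by end_near. Qed.

End stationary.

(** Differentiability gives continuity at a positive limit. It can fail at 0 when s < 1, where the
    estimate is made by hand. *)
Lemma cvg_powR {R : realType} (I : Type) (F : set_system I) {FF : ProperFilter F}
    (f : I -> R) (l s : R) : 0 < s -> (forall x, 0 <= f x) ->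
  f x @[x --> F] --> l -> f x `^ s @[x --> F] --> l `^ s.
Proof.
move=> s0 f0 fl.
have : 0 <= l.
  by rewrite -(cvg_lim _ fl)//; apply: limr_ge; [exact: cvgP fl|exact: nearW].
rewrite le_eqVlt => /predU1P[l0|l0].
- rewrite -l0 powR0 ?gt_eqF//; apply/cvgr0Pnorm_lt => e e0.
  rewrite -l0 in fl; have e'0 : 0 < e `^ s^-1 by rewrite powR_gt0.
  move/cvgr0Pnorm_lt : fl => /(_ _ e'0); apply: filterS => x.
  rewrite !ger0_norm ?powR_ge0// => fe.
  have -> : e = (e `^ s^-1) `^ s by rewrite -powRrM mulVf ?gt_eqF// powRr1// ltW.
  by rewrite gt0_ltr_powR// nnegrE// ltW.
- have cs : {for l, continuous (fun x : R => x `^ s)}.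
    apply: differentiable_continuous; apply/derivable1_diffP.
    by apply: derivable_powR; rewrite in_itv/= l0.
  exact: (continuous_cvg _ cs fl).
Qed.

Lemma continuous_normr_powR {R : realType} (s : R) : 0 < s ->
  continuous (fun y : R => `|y| `^ s).
Proof.
move=> s0 y.
have ny : `|x| @[x --> y] --> `|y| by exact: norm_continuous.
exact: (cvg_powR s0 (@normr_ge0 _ _) ny).
Qed.

(** Fubini for a signed integrand, reduced to Tonelli on its positive and negative parts. The finite
    iterated integral of the absolute value makes both parts integrable. *)
Lemma independent_integrable {R : realType} d (T : measurableType d)
    (P : probability T R) d' (T' : measurableType d') (P' : probability T' R)
    d1 (E : measurableType d1) d2 (S : measurableType d2)
    (Z : {mfun T >-> E}) (W : {mfun T >-> S}) (Z' : {mfun T' >-> E})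
    (f : E * S -> R) :
    independent2 P Z W -> same_law P P' Z Z' -> measurable_fun setT f ->
    (\int[P]_w \int[P']_w' `|(f (Z' w', W w))%:E| < +oo)%E ->
  P.-integrable setT (fun w => (f (Z w, W w))%:E) /\
  (\int[P]_w (f (Z w, W w))%:E = \int[P]_w \int[P']_w' (f (Z' w', W w))%:E)%E.
Proof.
move=> ZW ZZ' mf foo.
have mZW : measurable_fun setT (fun w => (Z w, W w)).
  by apply: measurable_fun_pair.
have mEf : measurable_fun setT (EFin \o f) by exact/measurable_EFinP.
have mZ'W w : measurable_fun setT (fun w' => (Z' w', W w)).
  exact: measurable_fun_pair.
have iint (F : E * S -> \bar R) : measurable_fun setT F ->
    (forall x, 0 <= F x)%E -> (forall x, F x <= `|(f x)%:E|)%E ->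
    P.-integrable setT (fun w => \int[P']_w' F (Z' w', W w))%E.
  move=> mF F0 Ff.
  have mF' : measurable_fun setT (fun w => \int[P']_w' F (Z' w', W w))%E.
    pose h (x : T' * S) := F (Z' x.1, x.2).
    have mh : measurable_fun setT h.
      apply: (measurableT_comp mF); apply: measurable_fun_pair => //.
      exact: measurableT_comp.
    apply: (@measurableT_comp _ _ _ _ _ _ (fubini_G P' h)) => //.
    by apply: measurable_fun_fubini_tonelli_G => // x; exact: F0.
  apply/integrableP; split => //; apply: le_lt_trans foo.
  apply: ge0_le_integral => //.
  - exact: measurableT_comp.
  - pose h (x : T' * S) := `|(f (Z' x.1, x.2))%:E|%E.
    have mh : measurable_fun setT h.
      apply: measurableT_comp => //; apply: (measurableT_comp mEf).
      apply: measurable_fun_pair => //; exact: measurableT_comp.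
    apply: (@measurableT_comp _ _ _ _ _ _ (fubini_G P' h)) => //.
    by apply: measurable_fun_fubini_tonelli_G => // x; exact: abse_ge0.
  - move=> w _; rewrite gee0_abs ?integral_ge0//.
    apply: ge0_le_integral => //.
    + exact: (measurableT_comp mF).
    + apply: measurableT_comp => //; exact: (measurableT_comp mEf).
pose fp := funepos (EFin \o f); pose fn := funeneg (EFin \o f).
have mfp : measurable_fun setT fp by exact: measurable_funepos.
have mfn : measurable_fun setT fn by exact: measurable_funeneg.
have fp0 x : (0 <= fp x)%E by exact: funepos_ge0.
have fn0 x : (0 <= fn x)%E by exact: funeneg_ge0.
have fabs x : (`|(f x)%:E| = fp x + fn x)%E.
  by rewrite -[LHS]/((abse \o (EFin \o f)) x) fune_abse.
have fpi : P.-integrable setT (fun w => \int[P']_w' fp (Z' w', W w))%E.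
  by apply: iint => // x; rewrite fabs leeDl.
have fni : P.-integrable setT (fun w => \int[P']_w' fn (Z' w', W w))%E.
  by apply: iint => // x; rewrite fabs leeDr.
have mabs : measurable_fun setT (fun x => `|(f x)%:E|)%E by exact: measurableT_comp.
split.
- apply/integrableP; split; first exact: (measurableT_comp mEf mZW).
  by rewrite (integral_independent ZW ZZ' mabs).
- rewrite integralE.
  have -> : (\int[P]_w (funepos (fun w => (f (Z w, W w))%:E) w) =
      \int[P]_w \int[P']_w' fp (Z' w', W w))%E.
    rewrite -(integral_independent ZW ZZ' mfp fp0).
    by apply: eq_integral => w _; rewrite /fp !funeposE.
  have -> : (\int[P]_w (funeneg (fun w => (f (Z w, W w))%:E) w) =
      \int[P]_w \int[P']_w' fn (Z' w', W w))%E.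
    rewrite -(integral_independent ZW ZZ' mfn fn0).
    by apply: eq_integral => w _; rewrite /fn !funenegE.
  rewrite -integralB//; apply: eq_integral => w _.
  rewrite [RHS]integralE; congr (_ - _)%E; apply: eq_integral => w' _.
    by rewrite /fp !funeposE.
  by rewrite /fn !funenegE.
Qed.

(** * Convergence of the mean increments *)

Section increments.
Context {R : realType} d (T : measurableType d) (P : probability T R).
Context d1 (E : measurableType d1).
Variable Z : nat -> {mfun T >-> E}.
Hypothesis indepZ : mutual_independence P (fun n => Z n : T -> E).
Context d' (T' : measurableType d') (P' : probability T' R).
Variable Z' : {mfun T' >-> E}.
Hypothesis lawZ : forall n, same_law P P' (Z n) Z'.
Variable (g : E -> R -> R).
Hypothesis mg : measurable_fun setT (fun x : E * R => g x.1 x.2).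
Variable X : {mfun T' >-> R}.
Hypothesis indepX : independent2 P' Z' X.
Hypothesis lawX : same_law P' P' X (fun w => g (Z' w) (X w)).
Variables (s : R) (G : T -> \bar R) (Xinf : T -> R).
Hypotheses (s_gt0 : 0 < s) (iG : P.-integrable setT G).
Hypothesis mXinf : measurable_fun setT Xinf.
Hypothesis cvgX :
  {ae P, forall w x, iterated Z g 0 n x w @[n --> \oo] --> Xinf w}.
Hypothesis itG : forall w n, ((`|iterated Z g 0 n 0%R w| `^ s)%:E <= G w)%E.
Variables (h : E -> R -> R) (D : E -> R).
Hypothesis mh : measurable_fun setT (fun x : E * R => h x.1 x.2).
Hypothesis ch : forall z, continuous (h z).
Hypothesis mD : measurable_fun setT D.
Hypothesis hD : forall z y, `|h z y| <= D z * (1 + `|y| `^ s).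
Hypothesis D_lty : (\int[P']_w (D (Z' w))%:E < +oo)%E.

Let D0 z : 0 <= D z.
Proof.
have := hD z 0; rewrite normr0 powR0 ?gt_eqF// addr0 mulr1.
exact: le_trans.
Qed.

Let c := fine (\int[P']_w (D (Z' w))%:E).

Let cE : (\int[P']_w (D (Z' w))%:E)%E = c%:E.
Proof.
rewrite /c fineK// ge0_fin_numE// integral_ge0// => w _; rewrite lee_fin.
exact: D0.
Qed.

Let mDZ : measurable_fun setT (fun w => (D (Z' w))%:E).
Proof. by apply/measurable_EFinP; exact: measurableT_comp. Qed.

Let iD : P'.-integrable setT (fun w => (D (Z' w))%:E).
Proof.
apply/integrableP; split => //.
by under eq_integral do rewrite gee0_abs ?lee_fin ?D0//.
Qed.

Let mhZ y : measurable_fun setT (fun w => (h (Z' w) y)%:E).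
Proof.
apply/measurable_EFinP.
have mp : measurable_fun setT (fun w => (Z' w, y)) by exact: measurable_fun_pair.
exact: (measurableT_comp mh mp).
Qed.

Let iDy r : P'.-integrable setT (fun w => (D (Z' w) * r)%:E).
Proof. by under eq_fun do rewrite EFinM; exact: integrableZr. Qed.

Lemma integrable_increment y : P'.-integrable setT (fun w => (h (Z' w) y)%:E).
Proof.
apply: le_integrable (iDy (1 + `|y| `^ s)) => // w _; rewrite /= lee_fin.
by rewrite [leRHS]ger0_norm// mulr_ge0// addr_ge0// powR_ge0.
Qed.

Definition mean_increment y : R := (\int[P']_w h (Z' w) y)%R.

Lemma mean_incrementE y :
  ((mean_increment y)%:E = \int[P']_w (h (Z' w) y)%:E)%E.
Proof.
rewrite /mean_increment /Rintegral fineK//.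
exact: integrable_fin_num (integrable_increment y).
Qed.

Lemma integral_abs_increment_le y :
  (\int[P']_w `|(h (Z' w) y)%:E| <= (c * (1 + `|y| `^ s))%:E)%E.
Proof.
rewrite EFinM -cE -integralZr//.
apply: ge0_le_integral => //.
- exact: measurableT_comp.
- by apply: emeasurable_funM.
- by move=> w _; rewrite /= -EFinM lee_fin.
Qed.

Lemma mean_increment_le y : `|mean_increment y| <= c * (1 + `|y| `^ s).
Proof.
rewrite -lee_fin -abse_EFin mean_incrementE.
apply: le_trans (integral_abs_increment_le y).
exact: le_abse_integral.
Qed.

Lemma continuous_mean_increment : continuous mean_increment.
Proof.
(* Any bounded neighbourhood of [y] would do: on it [D] times a constant dominates the integrand. *)
move=> y; pose M := `|y| + 1.
have yM : y \in (`]- M, M[%classic : set R).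
  by rewrite inE/= in_itv/= -ltr_norml /M ltrDl.
apply: (@continuity_under_integral R _ _ P' (fun y w => h (Z' w) y) setT
  measurableT (- M) M _ _ (fun w => D (Z' w) * (1 + M `^ s)) _ _ y yM).
- by move=> x _; exact: integrable_increment.
- by apply: aeW => w _ x _; exact: ch.
- exact: iDy.
- move=> x /=; rewrite in_itv/= -ltr_norml => xM.
  apply: aeW => w _; apply: (le_trans (hD _ _)).
  rewrite ler_wpM2l// lerD2l; apply: ler_powRl => //; exact: ltW.
Qed.

Let mH : measurable_fun setT (EFin \o mean_increment).
Proof.
apply/measurable_EFinP; apply: continuous_measurable_fun.
exact: continuous_mean_increment.
Qed.

Let iDG : P.-integrable setT (fun w => c%:E * (1 + G w))%E.
Proof.
apply: integrableZl => //; apply: integrableD => //.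
exact: (finite_measure_integrable_cst P 1 measurableT).
Qed.

Let c0 : 0 <= c.
Proof. by rewrite fine_ge0// integral_ge0// => w _; rewrite lee_fin. Qed.

Let HG w n :
  (`|(mean_increment (iterated Z g 0 n 0%R w))%:E| <= c%:E * (1 + G w))%E.
Proof.
apply: (@le_trans _ _ (c%:E * (1 + (`|iterated Z g 0 n 0%R w| `^ s)%:E))%E).
  by rewrite -EFinD -EFinM lee_fin mean_increment_le.
by rewrite lee_wpmul2l ?lee_fin// leeD2l.
Qed.

Lemma integrable_mean_increment n :
  P.-integrable setT (fun w => (mean_increment (iterated Z g 0 n 0%R w))%:E).
Proof.
apply: le_integrable iDG => //.
  exact: (measurableT_comp mH (measurable_iterated Z mg _ _ _)).
by move=> w _; apply: (le_trans (HG w n)); rewrite lee_abs.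
Qed.

Let XinfG : (\int[P]_w (`|Xinf w| `^ s)%:E < +oo)%E.
Proof.
apply: (@le_lt_trans _ _ (\int[P]_w `|G w|)%E); last by case/integrableP: iG.
apply: ae_ge0_le_integral => //.
- exact: measurable_norm_powR.
- by apply: measurableT_comp => //; exact: measurable_int iG.
- apply: filterS cvgX => w /(_ 0) Hw _.
  have Hs : (`|iterated Z g 0 n 0%R w| `^ s)%:E @[n --> \oo] -->
      (`|Xinf w| `^ s)%:E.
    apply: cvg_EFin; first exact: nearW.
    exact: (cvg_powR s_gt0 (fun=> normr_ge0 _) (cvg_norm Hw)).
  rewrite -(cvg_lim _ Hs)//; apply: lime_le; first exact: cvgP Hs.
  by apply: nearW => n; rewrite (le_trans (itG w n))// lee_abs.
Qed.

(** No moment of [X] is assumed; this one is inherited from [Xinf], which the majorant [G]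
    controls. *)
Let XG : (\int[P']_w (`|X w| `^ s)%:E < +oo)%E.
Proof.
rewrite (integral_stationary_limit indepZ lawZ mg indepX lawX mXinf cvgX
  (continuous_normr_powR s_gt0))//.
Qed.

Let abs_stationary_lty :
  (\int[P']_w \int[P']_w' `|(h (Z' w') (X w))%:E| < +oo)%E.
Proof.
apply: (@le_lt_trans _ _ (\int[P']_w (c * (1 + `|X w| `^ s))%:E)%E).
  apply: ge0_le_integral => //.
  - by move=> w _; exact: integral_ge0.
  - pose k (x : T' * R) := `|(h (Z' x.1) x.2)%:E|%E.
    have mk : measurable_fun setT k.
      apply: measurableT_comp => //; apply/measurable_EFinP.
      have mp : measurable_fun setT (fun x : T' * R => (Z' x.1, x.2)).
        by apply: measurable_fun_pair => //; exact: measurableT_comp.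
      exact: (measurableT_comp mh mp).
    have mF : measurable_fun setT (fubini_G P' k).
      by apply: measurable_fun_fubini_tonelli_G => // x; exact: abse_ge0.
    exact: (measurableT_comp mF (measurable_funP X)).
  - apply/measurable_EFinP; apply: measurable_funM => //.
    apply: measurable_funD => //; apply/measurable_EFinP.
    exact: measurable_norm_powR.
  - by move=> w _; exact: integral_abs_increment_le.
under eq_integral do rewrite EFinM EFinD.
rewrite ge0_integralZl//; first last.
- by move=> w _; rewrite adde_ge0// lee_fin powR_ge0.
- by apply: emeasurable_funD => //; exact: measurable_norm_powR.
rewrite ge0_integralD//; last exact: measurable_norm_powR.
rewrite integral_prob_cst lte_mul_pinfty ?lee_fin//.
by rewrite lte_add_pinfty// ltry.
Qed.

Let HX :
  P'.-integrable setT (fun w => (h (Z' w) (X w))%:E) /\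
  (\int[P']_w (h (Z' w) (X w))%:E = \int[P']_w \int[P']_w' (h (Z' w') (X w))%:E)%E.
Proof.
exact: (@independent_integrable _ _ _ P' _ _ P' _ _ _ _ Z' X Z'
  (fun x => h x.1 x.2) indepX _ mh abs_stationary_lty).
Qed.

Lemma integrable_stationary_increment :
  P'.-integrable setT (fun w => (h (Z' w) (X w))%:E).
Proof. exact: HX.1. Qed.

(** Independence averages over the pair first; the remaining function of [X] is continuous but
    signed, so its positive and negative parts are transferred to [Xinf] separately. *)
Lemma integral_stationary_increment :
  (\int[P']_w (h (Z' w) (X w))%:E = \int[P]_w (mean_increment (Xinf w))%:E)%E.
Proof.
rewrite HX.2; under eq_integral do rewrite -mean_incrementE.
have cH := continuous_mean_increment.
have cHp : continuous (fun y => Num.max (mean_increment y) 0).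
  move=> y; have := @continuous_max R R mean_increment (cst 0) y (cH y).
  by move=> /(_ (@cst_continuous R R 0 y)).
have cHn : continuous (fun y => Num.max (- mean_increment y) 0).
  move=> y; have cN : {for y, continuous (fun y => - mean_increment y)}.
    exact: (cvgN (cH y)).
  have := @continuous_max R R _ (cst 0) y cN.
  by move=> /(_ (@cst_continuous R R 0 y)).
have lim := integral_stationary_limit indepZ lawZ mg indepX lawX mXinf cvgX.
rewrite integralE [RHS]integralE; congr (_ - _)%E.
- under eq_integral do rewrite funeposE -EFin_max.
  under [RHS]eq_integral do rewrite funeposE -EFin_max.
  by apply: (lim _ cHp) => y; rewrite le_max lexx orbT.
- under eq_integral do rewrite funenegE -EFinN -EFin_max.
  under [RHS]eq_integral do rewrite funenegE -EFinN -EFin_max.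
  by apply: (lim _ cHn) => y; rewrite le_max lexx orbT.
Qed.

Lemma cvg_mean_increment :
  (\int[P]_w (mean_increment (iterated Z g 0 n 0%R w))%:E)%E @[n --> \oo] -->
  (\int[P']_w (h (Z' w) (X w))%:E)%E.
Proof.
rewrite integral_stationary_increment.
have [] // := @dominated_convergence _ _ _ P setT measurableT
  (fun n w => (mean_increment (iterated Z g 0 n 0%R w))%:E)
  (fun w => (mean_increment (Xinf w))%:E) (fun w => c%:E * (1 + G w))%E.
- by move=> n; exact: (measurableT_comp mH (measurable_iterated Z mg _ _ _)).
- exact: (measurableT_comp mH mXinf).
- apply: filterS cvgX => w /(_ 0) Hw _; apply: cvg_EFin; first exact: nearW.
  have cH := continuous_mean_increment.
  exact: (continuous_cvg _ (cH _) Hw).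
- exact: aeW.
Qed.

End increments.

(** * Moments of |A| below the order alpha *)

Lemma probability_ae1 {R : realType} d (T : measurableType d)
    (P : probability T R) (S : set T) :
  measurable S -> {ae P, forall w, S w} -> P S = 1%E.
Proof.
move=> mS /negligibleP -/(_ (measurableC mS)) PS0.
have := probability_setC P (measurableC mS); rewrite setCK => ->.
by rewrite [P _]PS0 sube0.
Qed.

(** Integrating [powR_young_strict] bounds the moment by 1 minus a positive multiple of the mean of
    [J]. That mean vanishes only if |A| = 1 almost surely. *)
Lemma abs_moment_lt1 {R : realType} d (T : measurableType d)
    (P : probability T R) (A : {mfun T >-> R}) (alpha s : R) :
    0 < s < alpha -> (\int[P]_w (`|A w| `^ alpha)%:E = 1)%E ->
    ~ {ae P, forall w, `|A w| = 1} ->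
  exists2 phi, 0 <= phi < 1 & (\int[P]_w (`|A w| `^ s)%:E <= phi%:E)%E.
Proof.
move=> /andP[s0 sa] Aalpha nA; have a0 : 0 < alpha by exact: lt_trans sa.
pose th := s / alpha.
have th0 : 0 < th by rewrite divr_gt0.
have th1 : th < 1 by rewrite ltr_pdivrMr// mul1r.
pose J w := (`|A w| `^ (alpha / 2) - 1) ^+ 2.
have J0 w : 0 <= J w by exact: sqr_ge0.
have mpow r : measurable_fun setT (fun w => (`|A w| `^ r)%:E).
  exact: measurable_norm_powR.
have mJ : measurable_fun setT (fun w => (J w)%:E).
  apply/measurable_EFinP; apply: measurable_funX; apply: measurable_funB => //.
  by apply/measurable_EFinP; exact: mpow.
have k0 : 0 < th * (1 - th) by rewrite mulr_gt0// subr_gt0.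
have bound : (\int[P]_w (`|A w| `^ s)%:E +
    (th * (1 - th))%:E * \int[P]_w (J w)%:E <= 1)%E.
  rewrite -ge0_integralZl//; last 2 first.
  - by move=> w _; rewrite lee_fin.
  - by rewrite lee_fin ltW.
  rewrite -ge0_integralD//; last 2 first.
  - by move=> w _; rewrite -EFinM lee_fin mulr_ge0// ltW.
  - exact: measurable_funeM.
  have <- : (\int[P]_w (th%:E * (`|A w| `^ alpha)%:E + (1 - th)%:E) = 1)%E.
    rewrite ge0_integralD//; last 3 first.
    - by move=> w _; rewrite -EFinM lee_fin mulr_ge0 ?powR_ge0// ltW.
    - exact: measurable_funeM.
    - by move=> w _; rewrite lee_fin subr_ge0 ltW.
    rewrite ge0_integralZl//; last by rewrite lee_fin ltW.
    by rewrite Aalpha integral_prob_cst mule1 -EFinD addrC subrK.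
  apply: ge0_le_integral => //.
  - by move=> w _; rewrite -EFinM -EFinD lee_fin addr_ge0 ?powR_ge0// mulr_ge0// ltW.
  - by apply: emeasurable_funD => //; exact: measurable_funeM.
  - by apply: emeasurable_funD => //; exact: measurable_funeM.
  - move=> w _; rewrite -!EFinM -!EFinD lee_fin.
    by apply: powR_young_strict; rewrite ?s0.
have Is0 : (0 <= \int[P]_w (`|A w| `^ s)%:E)%E.
  by apply: integral_ge0 => w _; rewrite lee_fin powR_ge0.
have J_ge0 : (0 <= \int[P]_w (J w)%:E)%E.
  by apply: integral_ge0 => w _; rewrite lee_fin.
have J_gt0 : (0 < \int[P]_w (J w)%:E)%E.
  rewrite lt_neqAle J_ge0 andbT eq_sym; apply/eqP => J_eq0; apply: nA.
  have : (\int[P]_w `|(J w)%:E| = 0)%E.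
    by under eq_integral do rewrite gee0_abs ?lee_fin//.
  move/(ae_eq_integral_abs P measurableT mJ); apply: filterS => w /(_ Logic.I).
  move=> -[] /eqP; rewrite sqrf_eq0 subr_eq0 => /eqP.
  move=> /(congr1 (fun x => x `^ (alpha / 2)^-1)).
  rewrite -powRrM divff ?gt_eqF ?divr_gt0// powRr1//.
  by rewrite powR1.
have kJ : (0 < (th * (1 - th))%:E * \int[P]_w (J w)%:E)%E by rewrite mule_gt0.
have Isfin : (\int[P]_w (`|A w| `^ s)%:E)%E \is a fin_num.
  rewrite ge0_fin_numE//; apply: le_lt_trans (ltry 1).
  by apply: le_trans bound; rewrite leeDl// ltW.
have Is1 : (\int[P]_w (`|A w| `^ s)%:E < 1)%E.
  by rewrite (lt_le_trans _ bound)// lteDl.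
exists (fine (\int[P]_w (`|A w| `^ s)%:E)); last by rewrite fineK.
by rewrite fine_ge0//= -lte_fin fineK.
Qed.

(** If |A| = 1 almost surely, then ln |A| = 0 lies in every lattice; the lattice of integers already
    gives a contradiction. *)
Lemma non_arithmetic_abs {R : realType} d (T : measurableType d)
    (P : probability T R) (A : {mfun T >-> R}) :
    non_arithmetic (cond_law P (fun w => ln `|A w|) [set w | A w != 0]) ->
  ~ {ae P, forall w, `|A w| = 1}.
Proof.
move=> /(_ 1 ltr01) + A1; rewrite /cond_law.
have mA0 : measurable [set w | A w != 0].
  rewrite -[X in measurable X]setTI.
  have -> : [set w | A w != 0] = ~` (A @^-1` [set 0]).
    by apply/seteqP; split => w /=; [move/eqP|move=> /eqP].
  rewrite setTI; apply: measurableC; rewrite -[X in measurable X]setTI.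
  exact: measurable_funP.
have mS : measurable ((fun w => ln `|A w|) @^-1`
    [set 1 * k%:~R | k in [set: int]]).
  rewrite -[X in measurable X]setTI.
  have ml : measurable_fun setT (fun w => ln `|A w|).
    apply: measurableT_comp; first exact: measurable_ln.
    exact: measurableT_comp.
  apply: ml => //; apply: countable_measurable => //.
  apply: (@sub_countable _ _ _ [set: int]); last exact: countableP.
  exact: card_image_le.
have A1' w : `|A w| = 1 -> A w != 0 by move=> Aw; rewrite -normr_gt0 Aw.
rewrite (@probability_ae1 _ _ _ _ [set w | A w != 0])//; last first.
  by apply: filterS A1 => w /A1'.
rewrite probability_ae1 ?divr1 ?ltxx//; first exact: measurableI.
apply: filterS A1 => w Aw; split; last exact: A1'.
by exists 0 => //; rewrite Aw ln1 mulr0z mulr0.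
Qed.

Lemma lipschitz1_continuous {R : realType} (p : R -> R) :
  (forall u v, `|p u - p v| <= `|u - v|) -> continuous p.
Proof.
move=> plip x; apply/cvgrPdist_lt => e e0; near=> y.
apply: le_lt_trans (plip x y) _; near: y.
exact: (@cvgr_dist_lt _ _ _ _ _ id x (@cvg_id _ _)).
Unshelve. all: by end_near. Qed.

(** * The moment recursion for one part of the perpetuity *)

Section recursion.
Context {R : realType} d (T : measurableType d) (P : probability T R).
Variable Z : nat -> {mfun T >-> (R * R)%type}.
Hypothesis indepZ : mutual_independence P (fun n => Z n : T -> (R * R)%type).
Context d' (T' : measurableType d') (P' : probability T' R).
Variable Z' : {mfun T' >-> (R * R)%type}.
Hypothesis lawZ : forall n, same_law P P' (Z n) Z'.
Variable X : {mfun T' >-> R}.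
Let g := affine (@fst R R) (@snd R R).
Hypothesis indepX : independent2 P' Z' X.
Hypothesis lawX : same_law P' P' X (fun w => g (Z' w) (X w)).
Variable alpha : R.
Hypothesis alpha_gt0 : 0 < alpha.
Hypothesis a_moment : (\int[P']_w (`|(Z' w).1| `^ alpha)%:E = 1)%E.
Hypothesis b_moment : (\int[P']_w (`|(Z' w).2| `^ alpha)%:E < +oo)%E.
Hypothesis a_neq1 : ~ {ae P', forall w, `|(Z' w).1| = 1}.

Let W n w := iterated Z g 0 n (0 : R) w.

Let mg : measurable_fun setT (fun x : (R * R) * R => g x.1 x.2).
Proof. exact: (measurable_affine measurable_fst measurable_snd). Qed.

Let mW n : measurable_fun setT (W n).
Proof. exact: measurable_iterated. Qed.

Let mZ1 : measurable_fun setT (fun w => (Z' w).1).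
Proof. exact: measurableT_comp. Qed.

Let mZ2 : measurable_fun setT (fun w => (Z' w).2).
Proof. exact: measurableT_comp. Qed.

Let beta := fine (\int[P']_w (`|(Z' w).2| `^ alpha)%:E).

Let betaE : (\int[P']_w (`|(Z' w).2| `^ alpha)%:E)%E = beta%:E.
Proof.
by rewrite /beta fineK// ge0_fin_numE// integral_ge0.
Qed.

Let beta0 : 0 <= beta.
Proof. by rewrite fine_ge0// integral_ge0// => w _; rewrite lee_fin powR_ge0. Qed.

Let W_lty n : (\int[P]_w (`|W n w| `^ alpha)%:E < +oo)%E.
Proof.
apply: (@integral_iterated_powR_lty _ _ _ P _ _ Z indepZ _ _ P' Z' lawZ g
  (fun z => `|z.1|) (fun z => `|z.2|) mg _ _ _ _ _ alpha 1 beta) => //.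
- by apply: measurableT_comp => //; exact: measurable_fst.
- by apply: measurableT_comp => //; exact: measurable_snd.
- by move=> z y; rewrite /g /affine -normrM ler_normD.
- by under eq_integral do rewrite normr_id; rewrite a_moment.
- by under eq_integral do rewrite normr_id; rewrite betaE.
Qed.

Let limit_data s : 0 < s < alpha -> exists (G : T -> \bar R) (Xinf : T -> R),
  [/\ P.-integrable setT G, measurable_fun setT Xinf,
   {ae P, forall w x, iterated Z g 0 n x w @[n --> \oo] --> Xinf w} &
   forall w n, ((`|iterated Z g 0 n 0%R w| `^ s)%:E <= G w)%E].
Proof.
move=> /andP[s0 sa].
pose Z1 : {mfun T' >-> R} :=
  HB.pack (fun w => (Z' w).1) (isMeasurableFun.Build _ _ _ _ _ mZ1).
have [||phi phi01 Hphi] := @abs_moment_lt1 _ _ _ P' Z1 alpha s _ a_moment.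
- by rewrite s0.
- exact: a_neq1.
(* The last constant comes from (|b| + 1)^s <= 2^s (|b|^s + 1) and |b|^s <= 1 + |b|^alpha. *)
apply: (@perpetuity_limit _ _ _ P _ _ Z indepZ _ _ P' Z' lawZ fst snd
  measurable_fst measurable_snd s phi (2 `^ s * (1 + beta + 1))) => //.
  by rewrite mulr_ge0 ?powR_ge0// !addr_ge0.
apply: (@le_trans _ _ (\int[P']_w (2 `^ s * (1 + `|(Z' w).2| `^ alpha + 1))%:E)%E).
  apply: ge0_le_integral => //.
  - apply/measurable_EFinP; apply: (measurableT_comp (measurable_powR s)).
    by apply: measurable_funD => //; exact: measurableT_comp.
  - apply/measurable_EFinP; apply: measurable_funM => //.
    apply: measurable_funD => //; apply: measurable_funD => //.
    by apply/measurable_EFinP; exact: measurable_norm_powR.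
  - move=> w _; rewrite lee_fin; set b := (Z' w).2.
    have := @powR_addl_le R `|b| 1 s 1 (normr_ge0 _) ler01 ltr01 (ltW s0).
    rewrite invr1 powR1 -mulrDr => H; apply: (le_trans H).
    rewrite ler_wpM2l ?powR_ge0// lerD2r.
    have [b1|/ltW b1] := leP `|b| 1.
      rewrite -[leLHS]addr0 lerD ?powR_ge0//.
      apply: (@le_trans _ _ (1 `^ s)); last by rewrite powR1.
      exact: ler_powRl (ltW s0) (normr_ge0 _) b1.
    by rewrite -[leLHS]add0r lerD// ler_powR// ltW.
under eq_integral do rewrite EFinM !EFinD.
have mb : measurable_fun setT (fun w => (`|(Z' w).2| `^ alpha)%:E).
  exact: measurable_norm_powR.
rewrite ge0_integralZl//.
- rewrite !ge0_integralD//.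
  + by rewrite !integral_prob_cst betaE.
  + by move=> w _; rewrite adde_ge0// lee_fin powR_ge0.
  + exact: emeasurable_funD.
- by apply: emeasurable_funD => //; exact: emeasurable_funD.
- by move=> w _; rewrite !adde_ge0// lee_fin powR_ge0.
Qed.

Section part.
Variable p : R -> R.
Hypothesis p0 : forall u, 0 <= p u <= `|u|.
Hypothesis plip : forall u v, `|p u - p v| <= `|u - v|.

Let h (z : R * R) y := p (g z y) `^ alpha - p (z.1 * y) `^ alpha.

Let p_ge0 u : 0 <= p u.
Proof. by case/andP: (p0 u). Qed.

Let cp (u : R -> R) : continuous u -> continuous (fun y => p (u y) `^ alpha).
Proof.
move=> cu y; have pc := lipschitz1_continuous plip.
have py : p (u x) @[x --> y] --> p (u y).
  exact: (continuous_cvg _ (pc _) (cu y)).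
exact: (cvg_powR alpha_gt0 (fun=> p_ge0 _) py).
Qed.

Let mp : measurable_fun setT (fun y => p y `^ alpha).
Proof.
apply: continuous_measurable_fun; apply: (@cp id) => y; exact: cvg_id.
Qed.

Let mul_bound (z : R * R) y :
  p (z.1 * y) `^ alpha <= `|y| `^ alpha * `|z.1| `^ alpha.
Proof.
rewrite [leRHS]mulrC -powRM// -normrM; apply: ler_powRl (ltW alpha_gt0) (p_ge0 _) _.
by case/andP: (p0 (z.1 * y)).
Qed.

Let mZ1y y : measurable_fun setT (fun w => (p ((Z' w).1 * y) `^ alpha)%:E).
Proof.
by apply/measurable_EFinP; apply: (measurableT_comp mp); exact: measurable_funM.
Qed.

Let F y := (\int[P']_w (p ((Z' w).1 * y) `^ alpha)%:E)%E.

Let F_le y : (F y <= (`|y| `^ alpha)%:E)%E.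
Proof.
rewrite -[leRHS]mule1 -a_moment -ge0_integralZl//; last first.
  exact: measurable_norm_powR.
apply: ge0_le_integral => //.
- by move=> w _; rewrite lee_fin powR_ge0.
- by apply: measurable_funeM; exact: measurable_norm_powR.
- by move=> w _; rewrite -EFinM lee_fin.
Qed.

Let F0 y : (0 <= F y)%E.
Proof. by apply: integral_ge0 => w _; rewrite lee_fin powR_ge0. Qed.

Let mFW n : measurable_fun setT (fun w => F (W n w)).
Proof.
pose k (x : T' * R) := (p ((Z' x.1).1 * x.2) `^ alpha)%:E.
have mk : measurable_fun setT k.
  apply/measurable_EFinP; apply: (measurableT_comp mp).
  by apply: measurable_funM => //; exact: (measurableT_comp mZ1).
have mF : measurable_fun setT (fubini_G P' k).
  apply: measurable_fun_fubini_tonelli_G => // x.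
  by rewrite lee_fin powR_ge0.
exact: (measurableT_comp mF (mW n)).
Qed.

Let iFW n : P.-integrable setT (fun w => F (W n w)).
Proof.
apply/integrableP; split => //; apply: le_lt_trans (W_lty n).
apply: ge0_le_integral => //.
- exact: measurableT_comp.
- exact: measurable_norm_powR.
- by move=> w _; rewrite gee0_abs.
Qed.

(** Adding and subtracting the power of p(A W_n) isolates the increment. The subtracted term stays
    unexpanded, because the sign of A may exchange the two parts and its expansion involves both. *)
Lemma part_increments :
  P'.-integrable setT
    (fun w => (p (g (Z' w) (X w)) `^ alpha - p ((Z' w).1 * X w) `^ alpha)%:E) /\
  exists2 delta : nat -> R,
    delta n @[n --> \oo] --> fine (\int[P']_w
      (p (g (Z' w) (X w)) `^ alpha - p ((Z' w).1 * X w) `^ alpha)%:E) &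
    forall n, (\int[P]_w (p (W n.+1 w) `^ alpha)%:E =
      \int[P]_w \int[P']_w' (p ((Z' w').1 * W n w) `^ alpha)%:E + (delta n)%:E)%E.
Proof.
(* Half the minimum keeps [kappa] at most 1 and strictly between 0 and [alpha], that is, 0 < s <
   alpha <= s + 1. *)
pose kappa := Num.min 1 alpha / 2; pose s := alpha - kappa.
have k0 : 0 < kappa by rewrite divr_gt0// lt_min ltr01.
have k1 : kappa <= 1.
  by rewrite ler_pdivrMr// mul1r ge_min ler1n.
have ka : kappa < alpha.
  by rewrite ltr_pdivrMr// gt_min ltr_pMr// ltr1n orbT.
have s0 : 0 < s by rewrite subr_gt0.
have sa : s < alpha by rewrite ltrBlDr ltrDl.
have as1 : alpha <= s + 1 by rewrite /s addrAC lerBrDr lerD2l.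
have [|K K0 HK] := affine_powR_sub_le alpha_gt0 (ltW s0) _ p0 plip.
  by rewrite (ltW sa).
have [|G [Xinf [iG mXinf cvgX itG]]] := @limit_data s; first by rewrite s0.
pose D (z : R * R) := K * (`|z.1| `^ alpha + `|z.2| `^ alpha).
have mh : measurable_fun setT (fun x : (R * R) * R => h x.1 x.2).
  apply: measurable_funB; first exact: (measurableT_comp mp mg).
  apply: (measurableT_comp mp); apply: measurable_funM => //.
  by apply: measurableT_comp => //; exact: measurable_fst.
have ch z : continuous (h z).
  move=> y; apply: cvgB.
    apply: (@cp (g z)) => x; apply: cvgD; last exact: cvg_cst.
    by apply: cvgM; [exact: cvg_cst|exact: cvg_id].
  apply: (@cp (fun y => z.1 * y)) => x.
  by apply: cvgM; [exact: cvg_cst|exact: cvg_id].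
have mD : measurable_fun setT D.
  apply: measurable_funM => //; apply: measurable_funD.
    by apply/measurable_EFinP; apply: measurable_norm_powR; exact: measurable_fst.
  by apply/measurable_EFinP; apply: measurable_norm_powR; exact: measurable_snd.
have hD z y : `|h z y| <= D z * (1 + `|y| `^ s).
  by rewrite /D -mulrA; exact: HK.
have ma : measurable_fun setT (fun w => (`|(Z' w).1| `^ alpha)%:E).
  exact: measurable_norm_powR.
have mb : measurable_fun setT (fun w => (`|(Z' w).2| `^ alpha)%:E).
  exact: measurable_norm_powR.
have D_lty : (\int[P']_w (D (Z' w))%:E < +oo)%E.
  under eq_integral do rewrite EFinM EFinD.
  rewrite ge0_integralZl//; last 2 first.
  - exact: emeasurable_funD.
  - by move=> w _; rewrite adde_ge0// lee_fin powR_ge0.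
  by rewrite ge0_integralD// a_moment betaE -EFinD -EFinM ltry.
pose H := mean_increment P' Z' h.
have HE y : (H y)%:E = (\int[P']_w (h (Z' w) y)%:E)%E.
  exact: (mean_incrementE s0 mh mD hD D_lty).
have iHW n : P.-integrable setT (fun w => (H (W n w))%:E).
  exact: (integrable_mean_increment mg s0 iG itG mh ch mD hD D_lty).
have ihX := integrable_stationary_increment indepZ lawZ mg indepX lawX s0 iG
  mXinf cvgX itG mh mD hD D_lty.
split; first exact: ihX.
exists (fun n => fine (\int[P]_w (H (W n w))%:E)).
  have := cvg_mean_increment indepZ lawZ mg indepX lawX s0 iG
    mXinf cvgX itG mh ch mD hD D_lty.
  by rewrite -(fineK (integrable_fin_num measurableT ihX)) => /fine_cvg.
move=> n; rewrite fineK; last exact: integrable_fin_num (iHW n).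
have mpE : measurable_fun setT (fun y => (p y `^ alpha)%:E).
  exact/measurable_EFinP.
have pE0 y : (0 <= (p y `^ alpha)%:E)%E by rewrite lee_fin powR_ge0.
have := integral_iterated_transition mg indepZ lawZ 0 n 0 mpE pE0 => ->.
rewrite -integralD//; last exact: iFW.
apply: eq_integral => w _; rewrite HE -integralD//; last 2 first.
- apply/integrableP; split => //; apply: le_lt_trans (ltry (`|W n w| `^ alpha)).
  by under eq_integral do rewrite gee0_abs ?lee_fin ?powR_ge0//; exact: F_le.
- exact: (integrable_increment s0 mh mD hD D_lty).
by apply: eq_integral => w' _; rewrite -EFinD /h addrC subrK.
Qed.

Lemma integral_part_lty n : (\int[P]_w (p (W n w) `^ alpha)%:E < +oo)%E.
Proof.
apply: le_lt_trans (W_lty n); apply: ge0_le_integral => //.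
- by move=> w _; rewrite lee_fin powR_ge0.
- by apply/measurable_EFinP; exact: (measurableT_comp mp).
- exact: measurable_norm_powR.
- move=> w _; rewrite lee_fin; apply: ler_powRl (ltW alpha_gt0) (p_ge0 _) _.
  by case/andP: (p0 (W n w)).
Qed.

End part.

End recursion.

(** * The coupled recursion of the two moments *)

Section average_limits.
Context {R : realType}.

(** The sum and the difference diagonalize the recursion, with eigenvalues 1 and x - y; [u] is half
    of their total. If [y = 0], both eigenvalues are 1 and the equations decouple. *)
Lemma cvg_average_coupled (u v delta eps : nat -> R) (l m x y : R) :
    x + y = 1 -> 0 <= x -> 0 <= y ->
    (forall n, u n.+1 = x * u n + y * v n + delta n) ->
    (forall n, v n.+1 = y * u n + x * v n + eps n) ->
    delta n @[n --> \oo] --> l -> eps n @[n --> \oo] --> m ->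
  n%:R^-1 * u n @[n --> \oo] --> (if y == 0 then l else (l + m) / 2).
Proof.
move=> xy x0 y0 uS vS dl em.
case: eqP => [y_eq0|/eqP y_neq0].
  apply: (cvg_average_rec _ dl) => n; rewrite uS; move: xy.
  by rewrite y_eq0 addr0 => ->; rewrite mul1r mul0r addr0.
have sum : n%:R^-1 * (u n + v n) @[n --> \oo] --> l + m.
  apply: (@cvg_average_rec _ _ (fun n => delta n + eps n)); last exact: cvgD.
  move=> n; rewrite uS vS -[in RHS](mul1r (u n)) -[in RHS](mul1r (v n)) -xy.
  ring.
have yE : y = 1 - x by rewrite -xy addrAC subrr add0r.
have y_gt0 : 0 < y by rewrite lt_neqAle eq_sym y_neq0.
have dif : n%:R^-1 * (u n - v n) @[n --> \oo] --> (0 : R).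
  (* Here x - y lies in [-1, 1): the value 1 is excluded by y > 0, while -1 occurs when x = 0. *)
  apply: (@cvg_average_contraction _ _ (fun n => delta n - eps n) (x - y) (l - m)).
  - by rewrite ler_norml; apply/andP; split; lra.
  - by apply/eqP => H; lra.
  - by move=> n; rewrite uS vS; ring.
  - exact: cvgB.
have H : 2^-1 * (n%:R^-1 * (u n + v n) + n%:R^-1 * (u n - v n)) @[n --> \oo] -->
    2^-1 * (l + m + 0).
  by apply: cvgM; [exact: cvg_cst|exact: cvgD].
rewrite addr0 mulrC in H; apply: cvg_trans H; apply: near_eq_cvg; near=> n.
by move: (n%:R^-1) => k; field.
Unshelve. all: by end_near. Qed.

End average_limits.

(** * Positive and negative parts *)

Section parts.
Context {R : realType}.
Implicit Types (a x y alpha : R).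

Lemma neg_partE x : neg_part x = pos_part (- x).
Proof. by rewrite /neg_part /pos_part oppr_min oppr0. Qed.

Lemma pos_part_ge0 x : 0 <= pos_part x.
Proof. by rewrite /pos_part le_max lexx orbT. Qed.

Lemma pos_part_id x : 0 <= x -> pos_part x = x.
Proof. by move=> x0; apply/max_idPl. Qed.

Lemma pos_part_eq0 x : x <= 0 -> pos_part x = 0.
Proof. by move=> x0; apply/max_idPr. Qed.

Lemma pos_part_bounds x : 0 <= pos_part x <= `|x|.
Proof. by rewrite pos_part_ge0 /pos_part ge_max ler_norm normr_ge0. Qed.

Lemma neg_part_bounds x : 0 <= neg_part x <= `|x|.
Proof. by rewrite neg_partE -(normrN x) pos_part_bounds. Qed.

Lemma pos_part_lipschitz x y : `|pos_part x - pos_part y| <= `|x - y|.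
Proof.
wlog xy : x y / y <= x.
  move=> H; case: (leP y x) => [|/ltW]; first exact: H.
  by rewrite distrC (distrC x); exact: H.
rewrite [leRHS]ger0_norm ?subr_ge0//.
have [y0|/ltW y0] := leP 0 y.
  by rewrite !pos_part_id ?(le_trans y0)// ger0_norm// subr_ge0.
rewrite (pos_part_eq0 y0) subr0 ger0_norm ?pos_part_ge0//.
have [x0|/ltW x0] := leP 0 x; first by rewrite pos_part_id// lerBDr; lra.
by rewrite pos_part_eq0// subr_ge0.
Qed.

Lemma neg_part_lipschitz x y : `|neg_part x - neg_part y| <= `|x - y|.
Proof.
rewrite !neg_partE; apply: le_trans (pos_part_lipschitz _ _) _.
by rewrite -opprD normrN.
Qed.

(** A product is positive only when the signs of its factors agree, so at most one term on the right
    is nonzero. This is the source of the coupling coefficients p and q. *)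
Lemma pos_part_mul_powR alpha a y : 0 < alpha -> pos_part (a * y) `^ alpha =
  pos_part a `^ alpha * pos_part y `^ alpha +
  neg_part a `^ alpha * neg_part y `^ alpha.
Proof.
move=> alpha0; have z0 : (0 : R) `^ alpha = 0 by rewrite powR0 ?gt_eqF.
rewrite !neg_partE.
have [a0|/ltW a0] := leP 0 a; have [y0|/ltW y0] := leP 0 y.
- rewrite (pos_part_id (mulr_ge0 a0 y0)) (pos_part_id a0) (pos_part_id y0).
  rewrite !(@pos_part_eq0 (- _)) ?oppr_le0//.
  by rewrite z0 mul0r addr0 powRM.
- rewrite (@pos_part_eq0 (a * y)) ?mulr_ge0_le0// (pos_part_eq0 y0).
  by rewrite (@pos_part_eq0 (- a)) ?oppr_le0// z0 mulr0 mul0r addr0.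
- rewrite (@pos_part_eq0 (a * y)) ?mulr_le0_ge0// (pos_part_eq0 a0).
  by rewrite (@pos_part_eq0 (- y)) ?oppr_le0// z0 mulr0 mul0r addr0.
- rewrite (pos_part_eq0 a0) (pos_part_eq0 y0) z0 mul0r add0r.
  rewrite !pos_part_id ?oppr_ge0 ?mulr_le0//.
  by rewrite -powRM ?oppr_ge0// mulrNN.
Qed.

Lemma neg_part_mul_powR alpha a y : 0 < alpha -> neg_part (a * y) `^ alpha =
  pos_part a `^ alpha * neg_part y `^ alpha +
  neg_part a `^ alpha * pos_part y `^ alpha.
Proof.
move=> alpha0; rewrite (neg_partE (a * y)) -mulrN pos_part_mul_powR//.
by rewrite -neg_partE (neg_partE (- y)) opprK.
Qed.

Lemma normr_powR_parts alpha x : 0 < alpha ->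
  `|x| `^ alpha = pos_part x `^ alpha + neg_part x `^ alpha.
Proof.
move=> alpha0; have z0 : (0 : R) `^ alpha = 0 by rewrite powR0 ?gt_eqF.
rewrite neg_partE; have [x0|/ltW x0] := leP 0 x.
  by rewrite ger0_norm// pos_part_id// pos_part_eq0 ?oppr_le0// z0 addr0.
by rewrite ler0_norm// (pos_part_eq0 x0) pos_part_id ?oppr_ge0// z0 add0r.
Qed.

End parts.

(** * From the given sequence to iterates, and the theorem *)

Lemma measurable_joint {R : realType} d (T : measurableType d)
    (Y Z : {mfun T >-> R}) : measurable_fun setT (joint Y Z).
Proof. exact: measurable_fun_pair. Qed.

HB.instance Definition _ {R : realType} d (T : measurableType d)
    (Y Z : {mfun T >-> R}) :=
  isMeasurableFun.Build _ _ _ _ (joint Y Z) (measurable_joint Y Z).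

Lemma mutual_independence_inj {R : realType} d (T : measurableType d)
    (P : probability T R) (I J : eqType) d' (E : measurableType d')
    (Z : I -> T -> E) (f : J -> I) : injective f ->
  mutual_independence P Z -> mutual_independence P (Z \o f).
Proof.
move=> finj indep s S us mS.
(* The sets are carried along [f]; outside the image of [s] the whole space imposes no constraint.
   Injectivity makes the chosen preimage the right one. *)
pose S' i := if pselect (exists2 j, j \in s & f j = i) is left e
  then S (sval (cid2 e)) else setT.
have S'f j : j \in s -> S' (f j) = S j.
  move=> js; rewrite /S'; case: pselect => [e|]; last by case; exists j.
  by case: cid2 => /= k _ /finj ->.
have mS' i : measurable (S' i) by rewrite /S'; case: pselect => // e; exact: mS.
have := indep (map f s) S'; rewrite map_inj_uniq// => /(_ us mS').
rewrite big_map.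
have -> : \bigcap_(i in [set` map f s]) (Z i @^-1` S' i) =
    \bigcap_(j in [set` s]) ((Z \o f) j @^-1` S j).
  apply/seteqP; split => w /= H.
    move=> j /= js; have := H (f j) (map_f f js); rewrite /= S'f//.
  by move=> _ /= /mapP[j js ->]; rewrite S'f//; exact: H.
by move=> ->; apply: eq_big_seq => j js; rewrite S'f.
Qed.

(** The perpetuity begins with the pair of index 1 and the iterates with index 0, hence the shift
    [k.+1]. The starting point 0 removes the last product. *)
Lemma partial_perpetuityE {R : realType} d (T : measurableType d)
    (As Bs : int -> {mfun T >-> R}) n w :
  partial_perpetuity As Bs n w =
  iterated (fun k => joint (As k.+1%:Z) (Bs k.+1%:Z) : {mfun T >-> (R * R)%type})
    (affine (@fst R R) (@snd R R)) 0 n 0 w.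
Proof.
rewrite iterated_affineE mulr0 addr0 /partial_perpetuity big_add1/=.
by apply: eq_bigr => i _; rewrite /Pi1 big_add1.
Qed.

Lemma integral_lin_comb {R : realType} d (T : measurableType d)
    (P : probability T R) (F1 F2 : T -> R) (r1 r2 k1 k2 : R) :
    measurable_fun setT F1 -> measurable_fun setT F2 ->
    (forall w, 0 <= F1 w) -> (forall w, 0 <= F2 w) -> 0 <= r1 -> 0 <= r2 ->
    (\int[P]_w (F1 w)%:E = k1%:E)%E -> (\int[P]_w (F2 w)%:E = k2%:E)%E ->
  (\int[P]_w (r1 * F1 w + r2 * F2 w)%:E = (r1 * k1 + r2 * k2)%:E)%E.
Proof.
move=> m1 m2 F10 F20 r10 r20 I1 I2.
have mE1 : measurable_fun setT (fun w => (F1 w)%:E) by exact/measurable_EFinP.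
have mE2 : measurable_fun setT (fun w => (F2 w)%:E) by exact/measurable_EFinP.
under eq_integral do rewrite EFinD !EFinM.
rewrite ge0_integralD//.
- rewrite ge0_integralZl ?lee_fin//; last by move=> w _; rewrite lee_fin.
  rewrite ge0_integralZl ?lee_fin//; last by move=> w _; rewrite lee_fin.
  by rewrite I1 I2 -!EFinM -EFinD.
- by move=> w _; rewrite mule_ge0// lee_fin.
- exact: measurable_funeM.
- by move=> w _; rewrite mule_ge0// lee_fin.
- exact: measurable_funeM.
Qed.

Lemma measurable_pos_part_powR {R : realType} d (T : measurableType d)
    (f : T -> R) (alpha : R) : measurable_fun setT f ->
  measurable_fun setT (fun w => pos_part (f w) `^ alpha).
Proof.
move=> mf; apply: (measurableT_comp (measurable_powR alpha)).
exact: measurable_maxr.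
Qed.

Lemma measurable_neg_part_powR {R : realType} d (T : measurableType d)
    (f : T -> R) (alpha : R) : measurable_fun setT f ->
  measurable_fun setT (fun w => neg_part (f w) `^ alpha).
Proof.
move=> mf; under eq_fun do rewrite neg_partE.
by apply: measurable_pos_part_powR; exact: measurableT_comp.
Qed.

(** Turns the case distinction in [tail_constant] into the condition q = 0 on the recursion. *)
Lemma neg_part_moment_eq0 {R : realType} d (T : measurableType d)
    (P : probability T R) (A : {mfun T >-> R}) (alpha : R) : 0 < alpha ->
  (\int[P]_w (neg_part (A w) `^ alpha)%:E = 0)%E <->
  P [set w | 0 <= A w] = 1%E.
Proof.
move=> alpha0.
have mS : measurable [set w | 0 <= A w].
  have -> : [set w | 0 <= A w] = A @^-1` `[0, +oo[.
    by apply/seteqP; split => w /=; rewrite in_itv/= andbT.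
  by rewrite -[X in measurable X]setTI; exact: measurable_funP.
have mF : measurable_fun setT (fun w => (neg_part (A w) `^ alpha)%:E).
  by apply/measurable_EFinP; exact: measurable_neg_part_powR.
have negA w : (neg_part (A w) `^ alpha == 0) = (0 <= A w).
  rewrite powR_eq0 (gt_eqF alpha0) /= andbT neg_partE.
  have [A0|A0] := leP 0 (A w); first by rewrite pos_part_eq0 ?oppr_le0 ?eqxx.
  by rewrite pos_part_id ?oppr_ge0 ?(ltW A0)// oppr_eq0 lt_eqF.
have neg0 w : (0 <= (neg_part (A w) `^ alpha)%:E)%E by rewrite lee_fin powR_ge0.
have -> : (\int[P]_w (neg_part (A w) `^ alpha)%:E =
    \int[P]_w `|(neg_part (A w) `^ alpha)%:E|)%E.
  by apply: eq_integral => w _; rewrite gee0_abs.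
split=> [/(ae_eq_integral_abs P measurableT mF) H|PS].
- apply: probability_ae1 => //; apply: filterS H => w /(_ Logic.I)[] /eqP.
  by rewrite negA.
- apply/(ae_eq_integral_abs P measurableT mF).
  have : {ae P, forall w, 0 <= A w}.
    apply/negligibleP; first exact: measurableC.
    by have := probability_setC P mS; rewrite PS subee.
  by apply: filterS => w; rewrite -negA => /eqP /= -> _.
Qed.

Theorem theorem6p2 (R : realType) (alpha : R) (alpha_gt0 : 0 < alpha)
    (* the i.i.d. sequence *)
    (d : measure_display) (T : measurableType d) (P : probability T R)
    (As Bs : int -> {RV P >-> R})
    (* the generic element and the stationary solution *)
    (d' : measure_display) (T' : measurableType d') (P' : probability T' R)
    (A B X : {RV P' >-> R})
    (iidAB : iid_copies P As Bs P' A B)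
    (A_moment : ('E_P'[fun w => (`|A w| `^ alpha)%R] = 1)%E)
    (B_moment : ('E_P'[fun w => (`|B w| `^ alpha)%R] < +oo)%E)
    (A_log_moment :
      ('E_P'[fun w => (`|A w| `^ alpha * log_plus `|A w|)%R] < +oo)%E)
    (no_fixpoint : forall x : R, (P' [set w | (A w * x + B w)%R = x] < 1)%E)
    (non_arith : non_arithmetic
      (cond_law P' (fun w => ln `|A w|) [set w | A w != 0]))
    (eta : R) (eta_gt0 : 0 < eta)
    (A_moment_eta : ('E_P'[fun w => (`|A w| `^ (alpha + eta))%R] < +oo)%E)
    (B_moment_eta : ('E_P'[fun w => (`|B w| `^ (alpha + eta))%R] < +oo)%E)
    (statX : stationary_solution P' A B X) :
  let c_plus := tail_constant P' alpha A B X (pos_part (R:=R)) in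
  let c_minus := tail_constant P' alpha A B X (neg_part (R:=R)) in
  let Xn := partial_perpetuity As Bs in
  [/\ c_plus \is a fin_num, c_minus \is a fin_num,
      (((alpha * rho P' alpha A * n%:R)^-1)%:E *
         'E_P[fun w => (pos_part (Xn n w) `^ alpha)%R])%E
        @[n --> \oo] --> c_plus &
      (((alpha * rho P' alpha A * n%:R)^-1)%:E *
         'E_P[fun w => (neg_part (Xn n w) `^ alpha)%R])%E
        @[n --> \oo] --> c_minus].
Proof.
move=> c_plus c_minus Xn.
have [indepAB lawAB] := iidAB; have [indepX lawX] := statX.
pose Z (k : nat) : {mfun T >-> (R * R)%type} := joint (As k.+1%:Z) (Bs k.+1%:Z).
pose Z' : {mfun T' >-> (R * R)%type} := joint A B.
have indepZ : mutual_independence P (fun k => Z k : T -> (R * R)%type).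
  apply: (@mutual_independence_inj _ _ _ P int nat _ _
    (fun t => joint (As t) (Bs t)) (fun k => k.+1%:Z)) => //.
  by move=> j k [].
have lawZ n : same_law P P' (Z n) Z' by exact: lawAB.
have indepX' : independent2 P' Z' X.
  by move=> S1 S2 mS1 mS2; rewrite setIC indepX// muleC.
have a_moment : (\int[P']_w (`|(Z' w).1| `^ alpha)%:E = 1)%E.
  by move: A_moment; rewrite unlock.
have b_moment : (\int[P']_w (`|(Z' w).2| `^ alpha)%:E < +oo)%E.
  by move: B_moment; rewrite unlock.
have a_neq1 : ~ {ae P', forall w, `|(Z' w).1| = 1} := non_arithmetic_abs non_arith.
have [ip [delta dl uS]] := part_increments indepZ lawZ indepX' lawX alpha_gt0
  a_moment b_moment a_neq1 (@pos_part_bounds R) (@pos_part_lipschitz R).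
have [im [eps em vS]] := part_increments indepZ lawZ indepX' lawX alpha_gt0
  a_moment b_moment a_neq1 (@neg_part_bounds R) (@neg_part_lipschitz R).
pose W n w := iterated Z (affine (@fst R R) (@snd R R)) 0 n (0 : R) w.
have mW n : measurable_fun setT (W n).
  exact: (measurable_iterated Z (measurable_affine measurable_fst measurable_snd)).
have XnE n w : Xn n w = W n w by exact: partial_perpetuityE.
pose u n := fine (\int[P]_w (pos_part (W n w) `^ alpha)%:E).
pose v n := fine (\int[P]_w (neg_part (W n w) `^ alpha)%:E).
have uE n : (\int[P]_w (pos_part (W n w) `^ alpha)%:E)%E = (u n)%:E.
  rewrite /u fineK// ge0_fin_numE; last first.
    by apply: integral_ge0 => w _; rewrite lee_fin powR_ge0.
  exact: (integral_part_lty indepZ lawZ alpha_gt0 a_moment b_moment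
    (@pos_part_bounds R) (@pos_part_lipschitz R)).
have vE n : (\int[P]_w (neg_part (W n w) `^ alpha)%:E)%E = (v n)%:E.
  rewrite /v fineK// ge0_fin_numE; last first.
    by apply: integral_ge0 => w _; rewrite lee_fin powR_ge0.
  exact: (integral_part_lty indepZ lawZ alpha_gt0 a_moment b_moment
    (@neg_part_bounds R) (@neg_part_lipschitz R)).
have mpA := @measurable_pos_part_powR R _ T' A alpha (measurable_funP A).
have mnA := @measurable_neg_part_powR R _ T' A alpha (measurable_funP A).
clearbody u v.
have I1_ge0 : (0 <= \int[P']_w (pos_part (A w) `^ alpha)%:E)%E.
  by apply: integral_ge0 => w _; rewrite lee_fin powR_ge0.
have I2_ge0 : (0 <= \int[P']_w (neg_part (A w) `^ alpha)%:E)%E.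
  by apply: integral_ge0 => w _; rewrite lee_fin powR_ge0.
have I12 : (\int[P']_w (pos_part (A w) `^ alpha)%:E +
    \int[P']_w (neg_part (A w) `^ alpha)%:E = 1)%E.
  rewrite -a_moment -ge0_integralD//.
  - by apply: eq_integral => w _; rewrite -EFinD -normr_powR_parts.
  - by move=> w _; rewrite lee_fin powR_ge0.
  - exact/measurable_EFinP.
  - by move=> w _; rewrite lee_fin powR_ge0.
  - exact/measurable_EFinP.
have ex_fin (x : \bar R) : (0 <= x)%E -> (x <= 1)%E ->
    exists2 c : R, 0 <= c & x = c%:E.
  by case: x => [r| |]//=; rewrite !lee_fin => r0 _; exists r.
have [|c1 c1_ge0 c1E] := ex_fin _ I1_ge0; first by rewrite -I12 leeDl.
have [|c2 c2_ge0 c2E] := ex_fin _ I2_ge0; first by rewrite -I12 (leeDr _ I1_ge0).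
have c12 : c1 + c2 = 1 by move: I12; rewrite c1E c2E -EFinD => -[].
have inner_pos : forall y, (\int[P']_w (pos_part (A w * y) `^ alpha)%:E)%E =
    (c1 * pos_part y `^ alpha + c2 * neg_part y `^ alpha)%:E.
  move=> y; rewrite mulrC (mulrC c2).
  rewrite -(integral_lin_comb mpA mnA
    (fun w => powR_ge0 _ _) (fun w => powR_ge0 _ _)
    (powR_ge0 _ _) (powR_ge0 _ _) c1E c2E).
  apply: eq_integral => w _; rewrite pos_part_mul_powR//.
  by rewrite mulrC (mulrC (neg_part (A w) `^ _)).
have inner_neg : forall y, (\int[P']_w (neg_part (A w * y) `^ alpha)%:E)%E =
    (c2 * pos_part y `^ alpha + c1 * neg_part y `^ alpha)%:E.
  move=> y; rewrite addrC mulrC (mulrC c2).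
  rewrite -(integral_lin_comb mpA mnA
    (fun w => powR_ge0 _ _) (fun w => powR_ge0 _ _)
    (powR_ge0 _ _) (powR_ge0 _ _) c1E c2E).
  apply: eq_integral => w _; rewrite neg_part_mul_powR//.
  by rewrite mulrC (mulrC (neg_part (A w) `^ _)).
have mpW n := measurable_pos_part_powR alpha (mW n).
have mnW n := measurable_neg_part_powR alpha (mW n).
have u_rec n : u n.+1 = c1 * u n + c2 * v n + delta n.
  suff : ((u n.+1)%:E = (c1 * u n + c2 * v n)%:E + (delta n)%:E)%E by move=> [].
  rewrite -uE uS -(integral_lin_comb (mpW n) (mnW n)
    (fun w => powR_ge0 _ _) (fun w => powR_ge0 _ _)
    c1_ge0 c2_ge0 (uE n) (vE n)).
  by congr (_ + _)%E; apply: eq_integral => w _; rewrite inner_pos.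
have v_rec n : v n.+1 = c2 * u n + c1 * v n + eps n.
  suff : ((v n.+1)%:E = (c2 * u n + c1 * v n)%:E + (eps n)%:E)%E by move=> [].
  rewrite -vE vS -(integral_lin_comb (mpW n) (mnW n)
    (fun w => powR_ge0 _ _) (fun w => powR_ge0 _ _)
    c2_ge0 c1_ge0 (uE n) (vE n)).
  by congr (_ + _)%E; apply: eq_integral => w _; rewrite inner_neg.
set l := fine _ in dl; set m := fine _ in em.
have lE : (\int[P']_w (pos_part (A w * X w + B w) `^ alpha -
    pos_part (A w * X w) `^ alpha)%:E)%E = l%:E.
  by rewrite /l fineK//; exact: integrable_fin_num ip.
have mE : (\int[P']_w (neg_part (A w * X w + B w) `^ alpha -
    neg_part (A w * X w) `^ alpha)%:E)%E = m%:E.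
  by rewrite /m fineK//; exact: integrable_fin_num im.
clearbody l m.
(* The absolute increment is the sum of the two part increments, so the second case of
   [tail_constant] amounts to the mean of [l] and [m]. *)
have lmE : (\int[P']_w (`|A w * X w + B w| `^ alpha -
    `|A w * X w| `^ alpha)%:E)%E = (l + m)%:E.
  rewrite EFinD -lE -mE -(integralD measurableT ip im).
  apply: eq_integral => w _; rewrite -EFinD !(normr_powR_parts _ alpha_gt0); congr (_%:E).
  by rewrite opprD addrACA.
pose L x := if c2 == 0 then x else (l + m) / 2.
have u_lim : n%:R^-1 * u n @[n --> \oo] --> L l.
  exact: (cvg_average_coupled c12 c1_ge0 c2_ge0 u_rec v_rec dl em).
have v_lim : n%:R^-1 * v n @[n --> \oo] --> L m.
  (* The recursion is symmetric under exchange of the two parts, so the same lemma applies with the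
     roles of [u] and [v] swapped. *)
  rewrite /L (addrC l).
  apply: (cvg_average_coupled c12 c1_ge0 c2_ge0 _ _ em dl) => n.
  - by rewrite v_rec [c2 * _ + _]addrC.
  - by rewrite u_rec [c1 * _ + _]addrC.
have PA : (P' [set w | 0 <= A w] == 1%E) = (c2 == 0).
  apply/eqP/eqP => [/(neg_part_moment_eq0 P' A alpha_gt0)|c2_eq0].
    by rewrite c2E => -[].
  by apply/(neg_part_moment_eq0 P' A alpha_gt0); rewrite c2E c2_eq0.
have constE part x : (\int[P']_w (part (A w * X w + B w) `^ alpha -
      part (A w * X w) `^ alpha)%:E)%E = x%:E ->
    tail_constant P' alpha A B X part = ((alpha * rho P' alpha A)^-1 * L x)%:E.
  move=> xE; rewrite /tail_constant PA /L unlock; case: ifP => _.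
    by rewrite xE -EFinM.
  rewrite lmE -EFinM; congr (_%:E).
  by rewrite -mulrA invfM -mulrA (mulrC (2^-1)) mulrA.
have limE (F : R -> R) (z : nat -> R) x :
    (forall n, (\int[P]_w (F (W n w))%:E)%E = (z n)%:E) ->
    n%:R^-1 * z n @[n --> \oo] --> x ->
  (((alpha * rho P' alpha A * n%:R)^-1)%:E * 'E_P[fun w => F (Xn n w)])%E
    @[n --> \oo] --> ((alpha * rho P' alpha A)^-1 * x)%:E.
  move=> zE zx.
  have -> : (fun n : nat => (((alpha * rho P' alpha A * n%:R)^-1)%:E *
      'E_P[fun w => F (Xn n w)])%E) =
      (fun n : nat => ((alpha * rho P' alpha A)^-1 * (n%:R^-1 * z n))%:E).
    apply/funext => n; rewrite unlock.
    under eq_integral do rewrite XnE.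
    (* As the inverse of 0 is 0, the factorization holds for every [n], including [n = 0]. *)
    by rewrite zE -EFinM invfM mulrA.
  apply: cvg_EFin; first exact: nearW.
  by apply: cvgM => //; exact: cvg_cst.
rewrite /c_plus /c_minus (constE _ _ lE) (constE _ _ mE); split => //.
- exact: (limE (fun x => pos_part x `^ alpha) u).
- exact: (limE (fun x => neg_part x `^ alpha) v).
Qed.
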